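(* Let $C$ be a category with pullbacks, $B$ a bicategory, and $\mathcal{S}=(U,V,\mathrm{BC})$ a $B$-valued Pith-Beck-Chevalley system on $C$. Then there is a pseudofunctor $\mathcal{F}_{\mathcal{S}}:\mathrm{Pith}(\mathrm{Span}(C))\to B$ such that: (1) $\mathcal{F}_{\mathcal{S}}(c)=U(c)$ for every $c\in C$; (2) for a span $S:c\xleftarrow{f}\widehat S\xrightarrow{g}c'$, $\mathcal{F}_{\mathcal{S}}(S)=U(g)V(f)$; (3) for spans $S:c\xleftarrow{f}\widehat S\xrightarrow{g}c'$, $S':c\xleftarrow{f'}\widehat{S'}\xrightarrow{g'}c'$ and an isomorphism of spans $\phi:\widehat S\xrightarrow{\sim}\widehat{S'}$ (so $f=f'\phi$, $g=g'\phi$), the 2-morphism $\mathcal{F}_{\mathcal{S}}(\phi):U(g)V(f)\to U(g')V(f')$ equals the composite $U(g)V(f)=U(g'\phi)V(f'\phi)\xrightarrow{U_{\mathrm{comp}}\cdot V_{\mathrm{comp}}}(U(g')U(\phi))(V(\phi)V(f'))\xrightarrow{\alpha^{-1}}((U(g')U(\phi))V(\phi))V(f')\xrightarrow{\alpha\cdot V(f')}(U(g')(U(\phi)V(\phi)))V(f')\xrightarrow{(U(g')\cdot\eta_{\mathcal S}(\phi))\cdot V(f')}(U(g')\mathrm{Id})V(f')\xrightarrow{\rho\cdot V(f')}U(g')V(f')$; (4) for spans $S:c\xleftarrow{f}\widehat S\xrightarrow{g}c'$ and $S':c'\xleftarrow{h}\widehat{S'}\xrightarrow{k}c''$, with composite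 apex $\widehat{S'S}=\widehat S\times_{c'}\widehat{S'}$ and projections $\pi_1:\widehat{S'S}\to\widehat S$, $\pi_2:\widehat{S'S}\to\widehat{S'}$, the composition isomorphism $(\mathcal{F}_{\mathcal{S}})_{\mathrm{comp},S,S'}:U(k\pi_2)V(f\pi_1)\to(U(k)V(h))(U(g)V(f))$ equals the composite $U(k\pi_2)V(f\pi_1)\xrightarrow{U_{\mathrm{comp}}\cdot V_{\mathrm{comp}}}(U(k)U(\pi_2))(V(\pi_1)V(f))\xrightarrow{\alpha^{-1}}((U(k)U(\pi_2))V(\pi_1))V(f)\xrightarrow{\alpha\cdot V(f)}(U(k)(U(\pi_2)V(\pi_1)))V(f)\xrightarrow{(U(k)\cdot\mathrm{BC}(\mathrm{Cs})^{-1})\cdot V(f)}(U(k)(V(h)U(g)))V(f)\xrightarrow{\alpha^{-1}\cdot V(f)}((U(k)V(h))U(g))V(f)\xrightarrow{\alpha}(U(k)V(h))(U(g)V(f))$, where $\mathrm{Cs}$ is the pullback square with top $\pi_1$, left $\pi_2$, right $g$, bottom $h$; (5) for $c\in C$, the unit isomorphism $(\mathcal F_{\mathcal S})_{\mathrm{Id}_c}:U(\mathrm{Id}_c)V(\mathrm{Id}_c)\to\mathrm{Id}$ equals $\lambda\circ(U_{\mathrm{Id}_c}\cdot V_{\mathrm{Id}_c})$.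
   Context: For a category $C$ with pullbacks, $\mathrm{Span}(C)$ is the bicategory with objects those of $C$, 1-morphisms spans $c\xleftarrow{l}\widehat S\xrightarrow{r}c'$, 2-morphisms maps of apices commuting with legs, composition by pullback, and canonical associators/unitors; $\mathrm{Pith}(\mathsf{B})$ is the sub-bicategory of a bicategory $\mathsf{B}$ keeping all objects and 1-morphisms but only invertible 2-morphisms. In a bicategory, $\alpha,\lambda,\rho$ denote associators and left/right unitors, $\cdot$ denotes whiskering, and composition of 1-morphisms is written $yx$ for $x$ then $y$. A $B$-valued Pith-Beck-Chevalley system on $C$ consists of: pseudofunctors $U:C\to B$ and $V:C^{\mathrm{op}}\to B$ agreeing on objects (with composition isomorphisms $U_{\mathrm{comp}}:U(gf)\cong U(g)U(f)$, $V_{\mathrm{comp}}:V(gf)\cong V(f)V(g)$ and unit isomorphisms $U_{\mathrm{Id}}:U(\mathrm{Id})\cong\mathrm{Id}$, $V_{\mathrm{Id}}:V(\mathrm{Id})\cong\mathrm{Id}$); and for every pullback square $S$ in $C$ with top $t:c_0\to c_1$, left $l:c_0\to c_2$, right $r:c_1\to c_3$, bottom $b:c_2\to c_3$, an isomorphism $\mathrm{BC}(S):V(b)U(r)\xrightarrow{\sim}U(l)V(t)$. These must satisfy: (horizontal pasting) for pullback squares $L$ (top $t_0$, left $v_0$, right $v_1$, bottom $b_0$) and $R$ (top $t_1$, left $v_1$, right $v_2$, bottom $b_1$) with pasted square $\mathrm{hcomp}(L,R)$, $(U(v_0)\cdot V_{\mathrm{comp}})\circ\mathrm{BC}(\mathrm{hcomp}(L,R))=\alpha\circ(\mathrm{BC}(L)\cdot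 V(t_1))\circ\alpha^{-1}\circ(V(b_0)\cdot\mathrm{BC}(R))\circ\alpha\circ(V_{\mathrm{comp}}\cdot U(v_2))$; (vertical pasting) for pullback squares $T$ (top $h_0$, left $l_0$, right $r_0$, bottom $h_1$) and $B$ (top $h_1$, left $l_1$, right $r_1$, bottom $h_2$) with pasted square $\mathrm{vcomp}(T,B)$, $(U_{\mathrm{comp}}\cdot V(h_0))\circ\mathrm{BC}(\mathrm{vcomp}(T,B))=\alpha^{-1}\circ(U(l_1)\cdot\mathrm{BC}(T))\circ\alpha\circ(\mathrm{BC}(B)\cdot U(r_0))\circ\alpha^{-1}\circ(V(h_2)\cdot U_{\mathrm{comp}})$; (horizontal unit squares) for $f:x\to y$ and the square with top $\mathrm{Id}_x$, left $f$, right $f$, bottom $\mathrm{Id}_y$, $\rho\circ(U(f)\cdot V_{\mathrm{Id}})\circ\mathrm{BC}=\lambda\circ(V_{\mathrm{Id}}\cdot U(f))$; (vertical unit squares) for $f:x\to y$ and the square with top $f$, left $\mathrm{Id}_x$, right $\mathrm{Id}_y$, bottom $f$, $\lambda\circ(U_{\mathrm{Id}}\cdot V(f))\circ\mathrm{BC}=\rho\circ(V(f)\cdot U_{\mathrm{Id}})$. For an isomorphism $\phi:x\to y$ in $C$, $\eta_{\mathcal S}(\phi):U(\phi)V(\phi)\to\mathrm{Id}_y$ is the composite $\lambda\circ(V_{\mathrm{Id}}\cdot U_{\mathrm{Id}})\circ\mathrm{BC}(S)^{-1}$ where $S$ is the pullback square with top $\phi$, left $\phi$, right $\mathrm{Id}_y$,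 bottom $\mathrm{Id}_y$. *)

(* Defs.v *)
From Stdlib Require Import ClassicalEpsilon.




Record Category := {
  ob :> Type;
  hom : ob -> ob -> Type;
  idm : forall a, hom a a;
  cmp : forall a b c, hom b c -> hom a b -> hom a c;
  cmp_assoc : forall a b c d (h : hom c d) (g : hom b c) (f : hom a b),
      cmp a b d (cmp b c d h g) f = cmp a c d h (cmp a b c g f);
  cmp_idl : forall a b (f : hom a b), cmp a b b (idm b) f = f;
  cmp_idr : forall a b (f : hom a b), cmp a a b f (idm a) = f }.

Arguments hom {_} _ _.
Arguments idm {_} _.
Arguments cmp {_ _ _ _} _ _.
Arguments cmp_assoc {_ _ _ _ _} _ _ _.
Arguments cmp_idl {_ _ _} _.
Arguments cmp_idr {_ _ _} _.

Definition op (C : Category) : Category := {|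
  ob := ob C;
  hom := fun a b => @hom C b a;
  idm := fun a => @idm C a;
  cmp := fun a b c g f => @cmp C c b a f g;
  cmp_assoc := fun a b c d h g f => eq_sym (@cmp_assoc C d c b a f g h);
  cmp_idl := fun a b f => @cmp_idr C b a f;
  cmp_idr := fun a b f => @cmp_idl C b a f |}.

Definition is_pullback {C : Category} {c0 c1 c2 c3 : C}
    (t : hom c0 c1) (l : hom c0 c2) (r : hom c1 c3) (b : hom c2 c3) : Prop :=
  cmp r t = cmp b l /\
  forall (x : C) (p : hom x c1) (q : hom x c2), cmp r p = cmp b q ->
    exists! u : hom x c0, cmp t u = p /\ cmp l u = q.

Record PB (C : Category) (a b c : C) (f : hom a c) (g : hom b c) := {
  pb_ob : C;
  pb_p1 : hom pb_ob a;
  pb_p2 : hom pb_ob b;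
  pb_is : is_pullback pb_p1 pb_p2 f g }.

Arguments PB {_ _ _ _} _ _.
Arguments pb_ob {_ _ _ _ _ _} _.
Arguments pb_p1 {_ _ _ _ _ _} _.
Arguments pb_p2 {_ _ _ _ _ _} _.
Arguments pb_is {_ _ _ _ _ _} _.

Record PbCategory := {
  pbcat :> Category;
  pullback : forall (a b c : pbcat) (f : hom a c) (g : hom b c), PB f g }.

Arguments pullback {_ _ _ _} _ _.

Lemma pb_comm {C : Category} {a b c : C} {f : hom a c} {g : hom b c} (P : PB f g) :
  cmp f (pb_p1 P) = cmp g (pb_p2 P).
Proof. exact (proj1 (pb_is P)). Qed.

Definition pb_lift {C : Category} {a b c : C} {f : hom a c} {g : hom b c} (P : PB f g)
    {x : C} (p : hom x a) (q : hom x b) (H : cmp f p = cmp g q) :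
    { u : hom x (pb_ob P) | cmp (pb_p1 P) u = p /\ cmp (pb_p2 P) u = q } :=
  let (u, Hu) := constructive_indefinite_description _ (proj2 (pb_is P) x p q H) in
  exist _ u (proj1 Hu).

Record BicatData := {
  b_ob : Type;
  b_hom : b_ob -> b_ob -> Type;
  b_cell : forall a b, b_hom a b -> b_hom a b -> Type;
  b_id1 : forall a, b_hom a a;
  b_comp : forall a b c, b_hom b c -> b_hom a b -> b_hom a c;
  b_id2 : forall a b (f : b_hom a b), b_cell a b f f;
  b_vcomp : forall a b (f g h : b_hom a b),
      b_cell a b g h -> b_cell a b f g -> b_cell a b f h;
  b_lw : forall a b c (g : b_hom b c) (f f' : b_hom a b),
      b_cell a b f f' -> b_cell a c (b_comp a b c g f) (b_comp a b c g f');
  b_rw : forall a b c (g g' : b_hom b c),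
      b_cell b c g g' -> forall (f : b_hom a b), b_cell a c (b_comp a b c g f) (b_comp a b c g' f);
  b_assoc : forall a b c d (h : b_hom c d) (g : b_hom b c) (f : b_hom a b),
      b_cell a d (b_comp a b d (b_comp b c d h g) f) (b_comp a c d h (b_comp a b c g f));
  b_lunit : forall a b (f : b_hom a b), b_cell a b (b_comp a b b (b_id1 b) f) f;
  b_runit : forall a b (f : b_hom a b), b_cell a b (b_comp a a b f (b_id1 a)) f }.

Arguments b_hom {_} _ _.
Arguments b_cell {_ _ _} _ _.
Arguments b_id1 {_} _.
Arguments b_comp {_ _ _ _} _ _.
Arguments b_id2 {_ _ _} _.
Arguments b_vcomp {_ _ _ _ _ _} _ _.
Arguments b_lw {_ _ _ _} _ {_ _} _.
Arguments b_rw {_ _ _ _ _ _} _ _.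
Arguments b_assoc {_ _ _ _ _} _ _ _.
Arguments b_lunit {_ _ _} _.
Arguments b_runit {_ _ _} _.

Record Bicategory := {
  bdata :> BicatData;
  b_assoc_inv : forall a b c d (h : b_hom c d) (g : b_hom b c) (f : b_hom a b),
      @b_cell bdata a d (b_comp h (b_comp g f)) (b_comp (b_comp h g) f);
  b_lunit_inv : forall a b (f : @b_hom bdata a b), b_cell f (b_comp (b_id1 b) f);
  b_runit_inv : forall a b (f : @b_hom bdata a b), b_cell f (b_comp f (b_id1 a));
  b_vassoc : forall a b (f g h k : @b_hom bdata a b)
      (x : b_cell h k) (y : b_cell g h) (z : b_cell f g),
      b_vcomp (b_vcomp x y) z = b_vcomp x (b_vcomp y z);
  b_vid_l : forall a b (f g : @b_hom bdata a b) (x : b_cell f g), b_vcomp (b_id2 g) x = x;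
  b_vid_r : forall a b (f g : @b_hom bdata a b) (x : b_cell f g), b_vcomp x (b_id2 f) = x;
  b_lw_id : forall a b c (g : @b_hom bdata b c) (f : b_hom a b),
      b_lw g (b_id2 f) = b_id2 (b_comp g f);
  b_rw_id : forall a b c (g : @b_hom bdata b c) (f : b_hom a b),
      b_rw (b_id2 g) f = b_id2 (b_comp g f);
  b_lw_vcomp : forall a b c (g : @b_hom bdata b c) (f f' f'' : b_hom a b)
      (x : b_cell f' f'') (y : b_cell f f'),
      b_lw g (b_vcomp x y) = b_vcomp (b_lw g x) (b_lw g y);
  b_rw_vcomp : forall a b c (g g' g'' : @b_hom bdata b c) (f : b_hom a b)
      (x : b_cell g' g'') (y : b_cell g g'),
      b_rw (b_vcomp x y) f = b_vcomp (b_rw x f) (b_rw y f);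
  b_interchange : forall a b c (g g' : @b_hom bdata b c) (f f' : b_hom a b)
      (x : b_cell g g') (y : b_cell f f'),
      b_vcomp (b_rw x f') (b_lw g y) = b_vcomp (b_lw g' y) (b_rw x f);
  b_assoc_nat1 : forall a b c d (h : @b_hom bdata c d) (g : b_hom b c) (f f' : b_hom a b)
      (x : b_cell f f'),
      b_vcomp (b_assoc h g f') (b_lw (b_comp h g) x) = b_vcomp (b_lw h (b_lw g x)) (b_assoc h g f);
  b_assoc_nat2 : forall a b c d (h : @b_hom bdata c d) (g g' : b_hom b c) (f : b_hom a b)
      (x : b_cell g g'),
      b_vcomp (b_assoc h g' f) (b_rw (b_lw h x) f) = b_vcomp (b_lw h (b_rw x f)) (b_assoc h g f);
  b_assoc_nat3 : forall a b c d (h h' : @b_hom bdata c d) (g : b_hom b c) (f : b_hom a b)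
      (x : b_cell h h'),
      b_vcomp (b_assoc h' g f) (b_rw (b_rw x g) f) = b_vcomp (b_rw x (b_comp g f)) (b_assoc h g f);
  b_assoc_inv_l : forall a b c d (h : @b_hom bdata c d) (g : b_hom b c) (f : b_hom a b),
      b_vcomp (b_assoc_inv _ _ _ _ h g f) (b_assoc h g f) = b_id2 _;
  b_assoc_inv_r : forall a b c d (h : @b_hom bdata c d) (g : b_hom b c) (f : b_hom a b),
      b_vcomp (b_assoc h g f) (b_assoc_inv _ _ _ _ h g f) = b_id2 _;
  b_lunit_nat : forall a b (f f' : @b_hom bdata a b) (x : b_cell f f'),
      b_vcomp x (b_lunit f) = b_vcomp (b_lunit f') (b_lw (b_id1 b) x);
  b_runit_nat : forall a b (f f' : @b_hom bdata a b) (x : b_cell f f'),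
      b_vcomp x (b_runit f) = b_vcomp (b_runit f') (b_rw x (b_id1 a));
  b_lunit_inv_l : forall a b (f : @b_hom bdata a b), b_vcomp (b_lunit_inv _ _ f) (b_lunit f) = b_id2 _;
  b_lunit_inv_r : forall a b (f : @b_hom bdata a b), b_vcomp (b_lunit f) (b_lunit_inv _ _ f) = b_id2 _;
  b_runit_inv_l : forall a b (f : @b_hom bdata a b), b_vcomp (b_runit_inv _ _ f) (b_runit f) = b_id2 _;
  b_runit_inv_r : forall a b (f : @b_hom bdata a b), b_vcomp (b_runit f) (b_runit_inv _ _ f) = b_id2 _;
  b_triangle : forall a b c (g : @b_hom bdata b c) (f : b_hom a b),
      b_vcomp (b_lw g (b_lunit f)) (b_assoc g (b_id1 b) f) = b_rw (b_runit g) f;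
  b_pentagon : forall a b c d e (k : @b_hom bdata d e) (h : b_hom c d) (g : b_hom b c)
      (f : b_hom a b),
      b_vcomp (b_assoc k h (b_comp g f)) (b_assoc (b_comp k h) g f)
      = b_vcomp (b_lw k (b_assoc h g f))
          (b_vcomp (b_assoc k (b_comp h g) f) (b_rw (b_assoc k h g) f)) }.

Arguments b_assoc_inv {_ _ _ _ _} _ _ _.
Arguments b_lunit_inv {_ _ _} _.
Arguments b_runit_inv {_ _ _} _.

Definition is_inv2 {B : BicatData} {a b : b_ob B} {f g : b_hom a b} (x : b_cell f g) : Prop :=
  exists y : b_cell g f, b_vcomp y x = b_id2 f /\ b_vcomp x y = b_id2 g.

Record iso2 (B : BicatData) (a b : b_ob B) (f g : b_hom a b) := {
  i2 : b_cell f g;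
  i2_inv : b_cell g f;
  i2_l : b_vcomp i2_inv i2 = b_id2 f;
  i2_r : b_vcomp i2 i2_inv = b_id2 g }.

Arguments iso2 {_ _ _} _ _.
Arguments i2 {_ _ _ _ _} _.
Arguments i2_inv {_ _ _ _ _} _.

Definition b_hcomp {B : BicatData} {a b c : b_ob B} {g g' : b_hom b c} {f f' : b_hom a b}
    (x : b_cell g g') (y : b_cell f f') : b_cell (b_comp g f) (b_comp g' f') :=
  b_vcomp (b_rw x f') (b_lw g y).

Definition cell_of_eq {B : BicatData} {a b : b_ob B} {f g : b_hom a b} (e : f = g) : b_cell f g :=
  match e in _ = y return b_cell f y with eq_refl => b_id2 f end.

(** * Pseudofunctors from a 1-category (viewed as a locally discrete bicategory)
      with prescribed object map [F0]. *)

Record PsFunCat (C : Category) (B : BicatData) (F0 : ob C -> b_ob B) := {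
  pf1 : forall a b : C, hom a b -> b_hom (F0 a) (F0 b);
  pf_comp : forall (a b c : C) (g : hom b c) (f : hom a b),
      iso2 (pf1 a c (cmp g f)) (b_comp (pf1 b c g) (pf1 a b f));
  pf_id : forall a : C, iso2 (pf1 a a (idm a)) (b_id1 (F0 a));
  pf_assoc : forall (a b c d : C) (h : hom c d) (g : hom b c) (f : hom a b),
      b_vcomp (b_assoc (pf1 c d h) (pf1 b c g) (pf1 a b f))
        (b_vcomp (b_rw (i2 (pf_comp b c d h g)) (pf1 a b f)) (i2 (pf_comp a b d (cmp h g) f)))
      = b_vcomp (b_lw (pf1 c d h) (i2 (pf_comp a b c g f)))
          (b_vcomp (i2 (pf_comp a c d h (cmp g f)))
             (cell_of_eq (f_equal (pf1 a d) (cmp_assoc h g f))));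
  pf_lunit : forall (a b : C) (f : hom a b),
      b_vcomp (b_lunit (pf1 a b f))
        (b_vcomp (b_rw (i2 (pf_id b)) (pf1 a b f)) (i2 (pf_comp a b b (idm b) f)))
      = cell_of_eq (f_equal (pf1 a b) (cmp_idl f));
  pf_runit : forall (a b : C) (f : hom a b),
      b_vcomp (b_runit (pf1 a b f))
        (b_vcomp (b_lw (pf1 a b f) (i2 (pf_id a))) (i2 (pf_comp a a b f (idm a))))
      = cell_of_eq (f_equal (pf1 a b) (cmp_idr f)) }.

Arguments pf1 {_ _ _} _ {_ _} _.
Arguments pf_comp {_ _ _} _ {_ _ _} _ _.
Arguments pf_id {_ _ _} _ _.

Record PBCdata (C : Category) (B : Bicategory) := {
  pbc_ob : ob C -> b_ob B;
  pbcU : PsFunCat C B pbc_ob;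
  pbcV : PsFunCat (op C) B pbc_ob;
  pbcBC : forall (c0 c1 c2 c3 : C) (t : hom c0 c1) (l : hom c0 c2) (r : hom c1 c3)
      (b : hom c2 c3), is_pullback t l r b ->
      iso2 (b_comp (@pf1 (op C) B pbc_ob pbcV c3 c2 b) (pf1 pbcU r))
           (b_comp (pf1 pbcU l) (@pf1 (op C) B pbc_ob pbcV c1 c0 t)) }.

Arguments pbc_ob {_ _} _ _.
Arguments pbcU {_ _} _.
Arguments pbcV {_ _} _.
Arguments pbcBC {_ _} _ {_ _ _ _ _ _ _ _} _.

Section PBCnotations.
Context {C : Category} {B : Bicategory} (S : PBCdata C B).

Definition Um {x y : C} (f : hom x y) : b_hom (pbc_ob S x) (pbc_ob S y) := pf1 (pbcU S) f.
Definition Vm {x y : C} (f : hom x y) : b_hom (pbc_ob S y) (pbc_ob S x) :=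
  @pf1 (op C) B (pbc_ob S) (pbcV S) y x f.
Definition Ucomp {x y z : C} (g : hom y z) (f : hom x y) :
  iso2 (Um (cmp g f)) (b_comp (Um g) (Um f)) := pf_comp (pbcU S) g f.
Definition Vcomp {x y z : C} (g : hom y z) (f : hom x y) :
  iso2 (Vm (cmp g f)) (b_comp (Vm f) (Vm g)) := @pf_comp (op C) B _ (pbcV S) z y x f g.
Definition Uid (x : C) : iso2 (Um (idm x)) (b_id1 (pbc_ob S x)) := pf_id (pbcU S) x.
Definition Vid (x : C) : iso2 (Vm (idm x)) (b_id1 (pbc_ob S x)) := @pf_id (op C) B _ (pbcV S) x.
Definition BC {c0 c1 c2 c3 : C} {t : hom c0 c1} {l : hom c0 c2} {r : hom c1 c3} {b : hom c2 c3}
  (H : is_pullback t l r b) : iso2 (b_comp (Vm b) (Um r)) (b_comp (Um l) (Vm t)) :=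
  pbcBC S H.

Definition BC_hpasting : Prop :=
  forall (c0 c1 c2 c3 c4 c5 : C) (t0 : hom c0 c1) (v0 : hom c0 c2) (v1 : hom c1 c3)
    (b0 : hom c2 c3) (t1 : hom c1 c4) (v2 : hom c4 c5) (b1 : hom c3 c5)
    (HL : is_pullback t0 v0 v1 b0) (HR : is_pullback t1 v1 v2 b1)
    (HLR : is_pullback (cmp t1 t0) v0 v2 (cmp b1 b0)),
    b_vcomp (b_lw (Um v0) (i2 (Vcomp t1 t0))) (i2 (BC HLR))
    = b_vcomp (b_assoc (Um v0) (Vm t0) (Vm t1))
       (b_vcomp (b_rw (i2 (BC HL)) (Vm t1))
       (b_vcomp (b_assoc_inv (Vm b0) (Um v1) (Vm t1))
       (b_vcomp (b_lw (Vm b0) (i2 (BC HR)))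
       (b_vcomp (b_assoc (Vm b0) (Vm b1) (Um v2))
                (b_rw (i2 (Vcomp b1 b0)) (Um v2)))))).

Definition BC_vpasting : Prop :=
  forall (c0 c1 c2 c3 c4 c5 : C) (h0 : hom c0 c1) (l0 : hom c0 c2) (r0 : hom c1 c3)
    (h1 : hom c2 c3) (l1 : hom c2 c4) (r1 : hom c3 c5) (h2 : hom c4 c5)
    (HT : is_pullback h0 l0 r0 h1) (HB : is_pullback h1 l1 r1 h2)
    (HTB : is_pullback h0 (cmp l1 l0) (cmp r1 r0) h2),
    b_vcomp (b_rw (i2 (Ucomp l1 l0)) (Vm h0)) (i2 (BC HTB))
    = b_vcomp (b_assoc_inv (Um l1) (Um l0) (Vm h0))
       (b_vcomp (b_lw (Um l1) (i2 (BC HT)))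
       (b_vcomp (b_assoc (Um l1) (Vm h1) (Um r0))
       (b_vcomp (b_rw (i2 (BC HB)) (Um r0))
       (b_vcomp (b_assoc_inv (Vm h2) (Um r1) (Um r0))
                (b_lw (Vm h2) (i2 (Ucomp r1 r0))))))).

Definition BC_hunit : Prop :=
  forall (x y : C) (f : hom x y) (H : is_pullback (idm x) f f (idm y)),
    b_vcomp (b_runit (Um f)) (b_vcomp (b_lw (Um f) (i2 (Vid x))) (i2 (BC H)))
    = b_vcomp (b_lunit (Um f)) (b_rw (i2 (Vid y)) (Um f)).

Definition BC_vunit : Prop :=
  forall (x y : C) (f : hom x y) (H : is_pullback f (idm x) (idm y) f),
    b_vcomp (b_lunit (Vm f)) (b_vcomp (b_rw (i2 (Uid x)) (Vm f)) (i2 (BC H)))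
    = b_vcomp (b_runit (Vm f)) (b_lw (Vm f) (i2 (Uid y))).

(** eta_S(phi) : U(phi) V(phi) => Id, for the pullback square with top phi, left phi,
    right Id, bottom Id (which is a pullback square when phi is an isomorphism). *)
Definition eta_S {x y : C} {phi : hom x y} (H : is_pullback phi phi (idm y) (idm y)) :
  b_cell (b_comp (Um phi) (Vm phi)) (b_id1 (pbc_ob S y)) :=
  b_vcomp (b_lunit (b_id1 (pbc_ob S y)))
    (b_vcomp (b_hcomp (i2 (Vid y)) (i2 (Uid y))) (i2_inv (BC H))).

End PBCnotations.

Record PBC (C : Category) (B : Bicategory) := {
  pbc_data :> PBCdata C B;
  pbc_hpasting : BC_hpasting pbc_data;
  pbc_vpasting : BC_vpasting pbc_data;
  pbc_hunit : BC_hunit pbc_data;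
  pbc_vunit : BC_vunit pbc_data }.

Section Span.
Context (C : PbCategory).

Record span (a b : C) := { apex : C; sl : hom apex a; sr : hom apex b }.
Arguments apex {_ _} _.
Arguments sl {_ _} _.
Arguments sr {_ _} _.

Definition smap {a b : C} (X Y : span a b) : Type :=
  { m : hom (apex X) (apex Y) | cmp (sl Y) m = sl X /\ cmp (sr Y) m = sr X }.

Definition sid (a : C) : span a a := {| apex := a; sl := idm a; sr := idm a |}.

Definition scomp {a b c : C} (Y : span b c) (X : span a b) : span a c :=
  {| apex := pb_ob (pullback (sr X) (sl Y));
     sl := cmp (sl X) (pb_p1 (pullback (sr X) (sl Y)));
     sr := cmp (sr Y) (pb_p2 (pullback (sr X) (sl Y))) |}.

Definition sid2 {a b : C} (X : span a b) : smap X X :=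
  exist _ (idm (apex X)) (conj (cmp_idr _) (cmp_idr _)).

Definition svcomp {a b : C} {X Y Z : span a b} (y : smap Y Z) (x : smap X Y) : smap X Z.
Proof.
  destruct y as [n [Hn1 Hn2]]; destruct x as [m [Hm1 Hm2]].
  exists (cmp n m); split; rewrite <- cmp_assoc; congruence.
Defined.

Definition slw {a b c : C} (Y : span b c) {X X' : span a b} (x : smap X X') :
  smap (scomp Y X) (scomp Y X').
Proof.
  destruct x as [m [Hm1 Hm2]].
  set (P := pullback (sr X) (sl Y)).
  set (P' := pullback (sr X') (sl Y)).
  assert (H : cmp (sr X') (cmp m (pb_p1 P)) = cmp (sl Y) (pb_p2 P)).
  { rewrite <- cmp_assoc, Hm2. apply pb_comm. }
  destruct (pb_lift P' _ _ H) as [u [Hu1 Hu2]].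
  exists u; simpl; fold P P'; split.
  - rewrite cmp_assoc, Hu1, <- cmp_assoc, Hm1. reflexivity.
  - rewrite cmp_assoc, Hu2. reflexivity.
Defined.

Definition srw {a b c : C} {Y Y' : span b c} (y : smap Y Y') (X : span a b) :
  smap (scomp Y X) (scomp Y' X).
Proof.
  destruct y as [m [Hm1 Hm2]].
  set (P := pullback (sr X) (sl Y)).
  set (P' := pullback (sr X) (sl Y')).
  assert (H : cmp (sr X) (pb_p1 P) = cmp (sl Y') (cmp m (pb_p2 P))).
  { rewrite <- cmp_assoc, Hm1. apply pb_comm. }
  destruct (pb_lift P' _ _ H) as [u [Hu1 Hu2]].
  exists u; simpl; fold P P'; split.
  - rewrite cmp_assoc, Hu1. reflexivity.
  - rewrite cmp_assoc, Hu2, <- cmp_assoc, Hm2. reflexivity.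
Defined.

Definition sassoc {a b c d : C} (Z : span c d) (Y : span b c) (X : span a b) :
  smap (scomp (scomp Z Y) X) (scomp Z (scomp Y X)).
Proof.
  set (Q := pullback (sr Y) (sl Z)).
  set (PL := pullback (sr X) (sl (scomp Z Y))).
  set (R := pullback (sr X) (sl Y)).
  set (PR := pullback (sr (scomp Y X)) (sl Z)).
  assert (H1 : cmp (sr X) (pb_p1 PL) = cmp (sl Y) (cmp (pb_p1 Q) (pb_p2 PL))).
  { rewrite <- cmp_assoc. apply (pb_comm PL). }
  destruct (pb_lift R _ _ H1) as [v [Hv1 Hv2]].
  assert (H2 : cmp (sr (scomp Y X)) v = cmp (sl Z) (cmp (pb_p2 Q) (pb_p2 PL))).
  { simpl; fold R. rewrite cmp_assoc. refine (eq_trans (f_equal _ Hv2) _).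
    rewrite <- !cmp_assoc. f_equal. apply (pb_comm Q). }
  destruct (pb_lift PR _ _ H2) as [u [Hu1 Hu2]].
  exists u; simpl; fold Q R PR; split.
  - rewrite cmp_assoc. refine (eq_trans (f_equal _ Hu1) _).
    rewrite cmp_assoc. refine (eq_trans (f_equal _ Hv1) _). reflexivity.
  - rewrite cmp_assoc. refine (eq_trans (f_equal _ Hu2) _).
    rewrite <- cmp_assoc. reflexivity.
Defined.

Definition slunit {a b : C} (X : span a b) : smap (scomp (sid b) X) X.
Proof.
  exists (pb_p1 (pullback (sr X) (sl (sid b)))); simpl; split.
  - reflexivity.
  - exact (pb_comm _).
Defined.

Definition srunit {a b : C} (X : span a b) : smap (scomp X (sid a)) X.
Proof.
  exists (pb_p2 (pullback (sr (sid a)) (sl X))); simpl; split.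
  - exact (eq_sym (pb_comm _)).
  - reflexivity.
Defined.

Definition SpanData : BicatData := {|
  b_ob := ob C;
  b_hom := span;
  b_cell := fun a b X Y => @smap a b X Y;
  b_id1 := sid;
  b_comp := fun a b c Y X => @scomp a b c Y X;
  b_id2 := fun a b X => @sid2 a b X;
  b_vcomp := fun a b X Y Z y x => @svcomp a b X Y Z y x;
  b_lw := fun a b c Y X X' x => @slw a b c Y X X' x;
  b_rw := fun a b c Y Y' y X => @srw a b c Y Y' y X;
  b_assoc := fun a b c d Z Y X => @sassoc a b c d Z Y X;
  b_lunit := fun a b X => @slunit a b X;
  b_runit := fun a b X => @srunit a b X |}.

End Span.

Arguments span {_} _ _.
Arguments apex {_ _ _} _.
Arguments sl {_ _ _} _.
Arguments sr {_ _ _} _.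
Arguments smap {_ _ _} _ _.

(** * Pseudofunctors out of Pith(D)

    Pith(D) keeps all objects and 1-morphisms of D but only its invertible
    2-morphisms.  A pseudofunctor Pith(D) -> E, with prescribed action [F0] on
    objects and [F1] on 1-morphisms, is therefore given by an action [pp2] on the
    invertible 2-cells of D (the invertibility proof is an argument), composition
    and unit isomorphisms, subject to the pseudofunctor axioms, which are required
    for all (invertible) 2-cells of D occurring in them. *)

Record PithPsFun (D E : BicatData) (F0 : b_ob D -> b_ob E)
    (F1 : forall a b : b_ob D, b_hom a b -> b_hom (F0 a) (F0 b)) := {
  pp2 : forall (a b : b_ob D) (f g : b_hom a b) (x : b_cell f g), is_inv2 x ->
      b_cell (F1 a b f) (F1 a b g);
  pp_comp : forall (a b c : b_ob D) (g : b_hom b c) (f : b_hom a b),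
      iso2 (F1 a c (b_comp g f)) (b_comp (F1 b c g) (F1 a b f));
  pp_id : forall a : b_ob D, iso2 (F1 a a (b_id1 a)) (b_id1 (F0 a));
  pp_id2 : forall (a b : b_ob D) (f : b_hom a b) (H : is_inv2 (b_id2 f)),
      pp2 a b f f (b_id2 f) H = b_id2 (F1 a b f);
  pp_vcomp : forall (a b : b_ob D) (f g h : b_hom a b) (x : b_cell f g) (y : b_cell g h)
      (Hx : is_inv2 x) (Hy : is_inv2 y) (Hyx : is_inv2 (b_vcomp y x)),
      pp2 a b f h (b_vcomp y x) Hyx = b_vcomp (pp2 a b g h y Hy) (pp2 a b f g x Hx);
  pp_nat_l : forall (a b c : b_ob D) (g : b_hom b c) (f f' : b_hom a b) (x : b_cell f f')
      (Hx : is_inv2 x) (Hgx : is_inv2 (b_lw g x)),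
      b_vcomp (i2 (pp_comp a b c g f')) (pp2 a c _ _ (b_lw g x) Hgx)
      = b_vcomp (b_lw (F1 b c g) (pp2 a b f f' x Hx)) (i2 (pp_comp a b c g f));
  pp_nat_r : forall (a b c : b_ob D) (g g' : b_hom b c) (f : b_hom a b) (x : b_cell g g')
      (Hx : is_inv2 x) (Hxf : is_inv2 (b_rw x f)),
      b_vcomp (i2 (pp_comp a b c g' f)) (pp2 a c _ _ (b_rw x f) Hxf)
      = b_vcomp (b_rw (pp2 b c g g' x Hx) (F1 a b f)) (i2 (pp_comp a b c g f));
  pp_assoc : forall (a b c d : b_ob D) (h : b_hom c d) (g : b_hom b c) (f : b_hom a b)
      (H : is_inv2 (b_assoc h g f)),
      b_vcomp (b_assoc (F1 c d h) (F1 b c g) (F1 a b f))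
        (b_vcomp (b_rw (i2 (pp_comp b c d h g)) (F1 a b f)) (i2 (pp_comp a b d (b_comp h g) f)))
      = b_vcomp (b_lw (F1 c d h) (i2 (pp_comp a b c g f)))
          (b_vcomp (i2 (pp_comp a c d h (b_comp g f))) (pp2 a d _ _ (b_assoc h g f) H));
  pp_lunit : forall (a b : b_ob D) (f : b_hom a b) (H : is_inv2 (b_lunit f)),
      b_vcomp (b_lunit (F1 a b f))
        (b_vcomp (b_rw (i2 (pp_id b)) (F1 a b f)) (i2 (pp_comp a b b (b_id1 b) f)))
      = pp2 a b _ _ (b_lunit f) H;
  pp_runit : forall (a b : b_ob D) (f : b_hom a b) (H : is_inv2 (b_runit f)),
      b_vcomp (b_runit (F1 a b f))
        (b_vcomp (b_lw (F1 a b f) (i2 (pp_id a))) (i2 (pp_comp a a b f (b_id1 a))))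
      = pp2 a b _ _ (b_runit f) H }.

Arguments pp2 {_ _ _ _} _ {_ _ _ _} _ _.
Arguments pp_comp {_ _ _ _} _ {_ _ _} _ _.
Arguments pp_id {_ _ _ _} _ _.

Section Formulas.
Context {C : PbCategory} {B : Bicategory} (S : PBCdata C B).

Definition spanF1 (a b : C) (X : span a b) : b_hom (pbc_ob S a) (pbc_ob S b) :=
  b_comp (Um S (sr X)) (Vm S (sl X)).

Definition F3formula {a b : C} {X Y : span a b} (x : smap X Y)
    (Hpb : is_pullback (proj1_sig x) (proj1_sig x) (idm (apex Y)) (idm (apex Y))) :
    b_cell (spanF1 a b X) (spanF1 a b Y) :=
  let phi := proj1_sig x in
  let e : spanF1 a b X = b_comp (Um S (cmp (sr Y) phi)) (Vm S (cmp (sl Y) phi)) :=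
      f_equal2 (fun r l => b_comp (Um S r) (Vm S l))
        (eq_sym (proj2 (proj2_sig x))) (eq_sym (proj1 (proj2_sig x))) in
  b_vcomp (b_rw (b_runit (Um S (sr Y))) (Vm S (sl Y)))
  (b_vcomp (b_rw (b_lw (Um S (sr Y)) (eta_S S Hpb)) (Vm S (sl Y)))
  (b_vcomp (b_rw (b_assoc (Um S (sr Y)) (Um S phi) (Vm S phi)) (Vm S (sl Y)))
  (b_vcomp (b_assoc_inv (b_comp (Um S (sr Y)) (Um S phi)) (Vm S phi) (Vm S (sl Y)))
  (b_vcomp (b_hcomp (i2 (Ucomp S (sr Y) phi)) (i2 (Vcomp S (sl Y) phi)))
           (cell_of_eq e))))).

Definition F4formula {a b c : C} (X : span a b) (Y : span b c) :
    b_cell (spanF1 a c (scomp C Y X)) (b_comp (spanF1 b c Y) (spanF1 a b X)) :=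
  let P := pullback (sr X) (sl Y) in
  b_vcomp (b_assoc (b_comp (Um S (sr Y)) (Vm S (sl Y))) (Um S (sr X)) (Vm S (sl X)))
  (b_vcomp (b_rw (b_assoc_inv (Um S (sr Y)) (Vm S (sl Y)) (Um S (sr X))) (Vm S (sl X)))
  (b_vcomp (b_rw (b_lw (Um S (sr Y)) (i2_inv (BC S (pb_is P)))) (Vm S (sl X)))
  (b_vcomp (b_rw (b_assoc (Um S (sr Y)) (Um S (pb_p2 P)) (Vm S (pb_p1 P))) (Vm S (sl X)))
  (b_vcomp (b_assoc_inv (b_comp (Um S (sr Y)) (Um S (pb_p2 P))) (Vm S (pb_p1 P)) (Vm S (sl X)))
           (b_hcomp (i2 (Ucomp S (sr Y) (pb_p2 P))) (i2 (Vcomp S (sl X) (pb_p1 P)))))))).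

Definition F5formula (a : C) : b_cell (spanF1 a a (sid C a)) (b_id1 (pbc_ob S a)) :=
  b_vcomp (b_lunit (b_id1 (pbc_ob S a))) (b_hcomp (i2 (Uid S a)) (i2 (Vid S a))).

End Formulas.

(* Main.v *)
From Stdlib Require Import ClassicalEpsilon ProofIrrelevance.
Require Import Defs.

(** A 2-cell of a bicategory is determined by its right whiskerings with all 1-cells [Z].  On
    these families, composites of 1-cells act by iterated composition [f1 (f2 (... Z))], so that
    all associators and unitors become identities and every coherence law of a
    Beck-Chevalley system becomes an equation between vertical composites.  In this strict
    calculus, gluing unit squares to a pullback square shows how its Beck-Chevalley cell changes
    when an isomorphism is absorbed at the apex or at one of the two feet of the cospan.  The
    apex case ([f4_iso_apex]) reduces functoriality, naturality, and the unit and associativity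
    axioms of the pseudofunctor to the two pasting laws and the two unit square laws. *)

Declare Scope cell_scope.
Delimit Scope cell_scope with cell.
Notation "x ∘ y" := (b_vcomp x y) (at level 40, left associativity) : cell_scope.
Local Open Scope cell_scope.

(** * Strictification of 2-cells of a bicategory *)

Section Strictification.
Context {B : Bicategory}.
Implicit Types a b c d x : b_ob B.

Lemma vcomp_cancel_r {a b} {f g h : b_hom a b} (x y : b_cell g h) (i : b_cell f g)
  (j : b_cell g f) : i ∘ j = b_id2 g -> x ∘ i = y ∘ i -> x = y.
Proof.
intros Hij H. apply (f_equal (fun z => z ∘ j)) in H.
rewrite !b_vassoc, Hij, !b_vid_r in H. exact H.
Qed.

Lemma vcomp_cancel_l {a b} {f g h : b_hom a b} (x y : b_cell f g) (i : b_cell g h)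
  (j : b_cell h g) : j ∘ i = b_id2 g -> i ∘ x = i ∘ y -> x = y.
Proof.
intros Hij H. apply (f_equal (fun z => j ∘ z)) in H.
rewrite <- !b_vassoc, Hij, !b_vid_l in H. exact H.
Qed.

Lemma postcomp {a b} {g h : b_hom a b} {x y : b_cell g h} (H : x = y)
  {f : b_hom a b} (w : b_cell f g) : x ∘ w = y ∘ w.
Proof. now rewrite H. Qed.

(** Naturality of the invertible left unitor recovers [x] from its whiskering by conjugation. *)
Lemma lw_id1_faithful {a b} {f g : b_hom a b} (x y : b_cell f g) :
  b_lw (b_id1 b) x = b_lw (b_id1 b) y -> x = y.
Proof.
intros H. apply (vcomp_cancel_r x y (b_lunit f) (b_lunit_inv f)).
- apply b_lunit_inv_r.
- now rewrite !b_lunit_nat, H.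
Qed.

Lemma rw_id1_faithful {a b} {f g : b_hom a b} (x y : b_cell f g) :
  b_rw x (b_id1 a) = b_rw y (b_id1 a) -> x = y.
Proof.
intros H. apply (vcomp_cancel_r x y (b_runit f) (b_runit_inv f)).
- apply b_runit_inv_r.
- now rewrite !b_runit_nat, H.
Qed.

(** Kelly's argument: whiskering with an identity is faithful and associators can be cancelled, so
    the law may be checked where pentagon and triangle apply. What then remains is naturality of the
    associator. *)
Lemma rw_lunit {a b c} (g : b_hom b c) (f : b_hom a b) :
  b_rw (b_lunit g) f = b_lunit (b_comp g f) ∘ b_assoc (b_id1 c) g f.
Proof.
apply lw_id1_faithful.
apply (vcomp_cancel_r _ _ (b_assoc (b_id1 c) (b_comp (b_id1 c) g) f) (b_assoc_inv _ _ _)).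
{ apply b_assoc_inv_r. }
apply (vcomp_cancel_r _ _ (b_rw (b_assoc (b_id1 c) (b_id1 c) g) f)
  (b_rw (b_assoc_inv (b_id1 c) (b_id1 c) g) f)).
{ now rewrite <- b_rw_vcomp, b_assoc_inv_r, b_rw_id. }
rewrite b_lw_vcomp, !b_vassoc, <- b_pentagon.
rewrite <- (b_vassoc _ _ _ _ _ _ _ _ (b_assoc _ _ (b_comp g f))), b_triangle.
rewrite <- b_vassoc, <- b_assoc_nat2, b_vassoc, <- b_rw_vcomp, b_triangle.
apply b_assoc_nat3.
Qed.

(* A bracketing of the 1-cell [f] as a composite of generators and identities.  Acting on
   all 1-cells [Z] by iterated composition from the right identifies all bracketings, so that
   on the resulting families of 2-cells associators and unitors become identities. *)
Inductive pres : forall a b, b_hom a b -> Type :=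
| pgen a b (f : b_hom a b) : pres a b f
| pone a : pres a a (b_id1 a)
| pcomp a b c (g : b_hom b c) (f : b_hom a b) :
    pres b c g -> pres a b f -> pres a c (b_comp g f).

Arguments pgen {a b} f.
Arguments pone {a}.
Arguments pcomp {a b c g f} _ _.

Fixpoint act {a b} {f : b_hom a b} (p : pres a b f) {x} : b_hom x a -> b_hom x b :=
  match p in pres a b f return b_hom x a -> b_hom x b with
  | pgen f => fun Z => b_comp f Z
  | pone => fun Z => Z
  | pcomp pg pf => fun Z => act pg (act pf Z)
  end.

Fixpoint actm {a b} {f : b_hom a b} (p : pres a b f) {x} :
    forall {Z Z' : b_hom x a}, b_cell Z Z' -> b_cell (act p Z) (act p Z') :=
  match p in pres a b f
    return forall Z Z' : b_hom x a, b_cell Z Z' -> b_cell (act p Z) (act p Z') with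
  | pgen f => fun Z Z' z => b_lw f z
  | pone => fun Z Z' z => z
  | pcomp pg pf => fun Z Z' z => actm pg (actm pf z)
  end.

(** The comparison of composition with [f] and the iterated action, made of associators and left
    unitors only; [nfi] is its inverse. *)
Fixpoint nf {a b} {f : b_hom a b} (p : pres a b f) {x} :
    forall Z : b_hom x a, b_cell (b_comp f Z) (act p Z) :=
  match p in pres a b f return forall Z : b_hom x a, b_cell (b_comp f Z) (act p Z) with
  | pgen f => fun Z => b_id2 (b_comp f Z)
  | pone => fun Z => b_lunit Z
  | @pcomp _ _ _ g f pg pf => fun Z =>
      nf pg (act pf Z) ∘ (b_lw g (nf pf Z) ∘ b_assoc g f Z)
  end.

Fixpoint nfi {a b} {f : b_hom a b} (p : pres a b f) {x} :
    forall Z : b_hom x a, b_cell (act p Z) (b_comp f Z) :=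
  match p in pres a b f return forall Z : b_hom x a, b_cell (act p Z) (b_comp f Z) with
  | pgen f => fun Z => b_id2 (b_comp f Z)
  | pone => fun Z => b_lunit_inv Z
  | @pcomp _ _ _ g f pg pf => fun Z =>
      b_assoc_inv g f Z ∘ (b_lw g (nfi pf Z) ∘ nfi pg (act pf Z))
  end.

Lemma nf_nfi {a b} {f : b_hom a b} (p : pres a b f) {x} (Z : b_hom x a) :
  nf p Z ∘ nfi p Z = b_id2 _.
Proof.
induction p as [a b f|a|a b c g f pg IHg pf IHf]; simpl.
- apply b_vid_l.
- apply b_lunit_inv_r.
- rewrite !b_vassoc, <- (b_vassoc _ _ _ _ _ _ _ (b_assoc g f Z)), b_assoc_inv_r, b_vid_l.
  rewrite <- (b_vassoc _ _ _ _ _ _ _ (b_lw g _) (b_lw g _)), <- b_lw_vcomp, IHf, b_lw_id, b_vid_l.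
  apply IHg.
Qed.

Lemma nfi_nf {a b} {f : b_hom a b} (p : pres a b f) {x} (Z : b_hom x a) :
  nfi p Z ∘ nf p Z = b_id2 _.
Proof.
induction p as [a b f|a|a b c g f pg IHg pf IHf]; simpl.
- apply b_vid_l.
- apply b_lunit_inv_l.
- rewrite !b_vassoc, <- (b_vassoc _ _ _ _ _ _ _ (nfi pg _)), IHg, b_vid_l.
  rewrite <- (b_vassoc _ _ _ _ _ _ _ (b_lw g _) (b_lw g _)), <- b_lw_vcomp, IHf, b_lw_id, b_vid_l.
  apply b_assoc_inv_l.
Qed.

Lemma nf_nat {a b} {f : b_hom a b} (p : pres a b f) {x} {Z Z' : b_hom x a} (z : b_cell Z Z') :
  nf p Z' ∘ b_lw f z = actm p z ∘ nf p Z.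
Proof.
induction p as [a b f|a|a b c g f pg IHg pf IHf]; simpl.
- now rewrite b_vid_l, b_vid_r.
- symmetry; apply b_lunit_nat.
- rewrite !b_vassoc, b_assoc_nat1.
  rewrite <- (b_vassoc _ _ _ _ _ _ _ (b_lw g _) (b_lw g _)), <- b_lw_vcomp, IHf, b_lw_vcomp.
  rewrite <- !b_vassoc. now rewrite IHg.
Qed.

(* The family [tau] is the strictification of the 2-cell [theta]. *)
Definition Rel {a b} {f g : b_hom a b} (p : pres a b f) (q : pres a b g) (theta : b_cell f g)
    (tau : forall x (Z : b_hom x a), b_cell (act p Z) (act q Z)) : Prop :=
  forall x (Z : b_hom x a), nf q Z ∘ b_rw theta Z = tau x Z ∘ nf p Z.

(** Since [nf] is invertible, this conjugate is the only family related to [theta] by [Rel]. *)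
Definition str {a b} {f g : b_hom a b} (p : pres a b f) (q : pres a b g) (theta : b_cell f g)
    {x} (Z : b_hom x a) : b_cell (act p Z) (act q Z) :=
  nf q Z ∘ (b_rw theta Z ∘ nfi p Z).

Lemma Rel_str {a b} {f g : b_hom a b} (p : pres a b f) (q : pres a b g) (theta : b_cell f g) :
  Rel p q theta (@str _ _ _ _ p q theta).
Proof. intros x Z. unfold str. now rewrite !b_vassoc, nfi_nf, b_vid_r. Qed.

(** The component at the identity 1-cell already determines the 2-cell, because whiskering with an
    identity is faithful. *)
Lemma Rel_inj {a b} {f g : b_hom a b} {p : pres a b f} {q : pres a b g}
  {theta theta' : b_cell f g} {tau tau'} :
  Rel p q theta tau -> Rel p q theta' tau' -> (forall x Z, tau x Z = tau' x Z) -> theta = theta'.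
Proof.
intros H H' E. apply rw_id1_faithful.
apply (vcomp_cancel_l _ _ (nf q _) (nfi q _) (nfi_nf _ _)).
now rewrite H, H', E.
Qed.

Lemma Rel_fun {a b} {f g : b_hom a b} {p : pres a b f} {q : pres a b g}
  {theta theta' : b_cell f g} {tau tau'} :
  Rel p q theta tau -> Rel p q theta' tau' -> theta = theta' ->
  forall x (Z : b_hom x a), tau x Z = tau' x Z.
Proof.
intros H H' <- x Z. apply (vcomp_cancel_r _ _ (nf p _) (nfi p _) (nf_nfi _ _)).
now rewrite <- H, H'.
Qed.

Lemma Rel_vcomp {a b} {f g h : b_hom a b} {p : pres a b f} {q : pres a b g} {r : pres a b h}
  {theta : b_cell g h} {theta' : b_cell f g} {tau tau'} :
  Rel q r theta tau -> Rel p q theta' tau' ->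
  Rel p r (theta ∘ theta') (fun x Z => tau x Z ∘ tau' x Z).
Proof.
intros H H' x Z. now rewrite b_rw_vcomp, <- b_vassoc, H, !b_vassoc, H'.
Qed.

Lemma Rel_id {a b} {f : b_hom a b} (p : pres a b f) :
  Rel p p (b_id2 f) (fun x Z => b_id2 (act p Z)).
Proof. intros x Z. now rewrite b_rw_id, b_vid_l, b_vid_r. Qed.

Lemma Rel_lw {a b c} {g : b_hom b c} (pg : pres b c g) {f f' : b_hom a b}
  {p : pres a b f} {q : pres a b f'} {theta : b_cell f f'} {tau} :
  Rel p q theta tau -> Rel (pcomp pg p) (pcomp pg q) (b_lw g theta) (fun x Z => actm pg (tau x Z)).
Proof.
intros H x Z; simpl. rewrite !b_vassoc, b_assoc_nat2.
rewrite <- (b_vassoc _ _ _ _ _ _ _ (b_lw g _) (b_lw g _)), <- b_lw_vcomp, H, b_lw_vcomp.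
rewrite <- !b_vassoc. now rewrite nf_nat.
Qed.

Lemma Rel_rw {a b c} {g g' : b_hom b c} {f : b_hom a b} (pf : pres a b f)
  {p : pres b c g} {q : pres b c g'} {theta : b_cell g g'} {tau} :
  Rel p q theta tau ->
  Rel (pcomp p pf) (pcomp q pf) (b_rw theta f) (fun x Z => tau x (act pf Z)).
Proof.
intros H x Z; simpl. rewrite !b_vassoc, b_assoc_nat3.
rewrite <- (b_vassoc _ _ _ _ _ _ _ (b_lw g' _)), <- b_interchange.
rewrite <- !b_vassoc. now rewrite H.
Qed.

(** The pentagon, together with naturality of the associator, is exactly what turns the associator
    into an identity. For the unitors below, the same role is played by [rw_lunit] and the
    triangle. *)
Lemma Rel_assoc {a b c d} {h : b_hom c d} {g : b_hom b c} {f : b_hom a b}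
  (ph : pres c d h) (pg : pres b c g) (pf : pres a b f) :
  Rel (pcomp (pcomp ph pg) pf) (pcomp ph (pcomp pg pf)) (b_assoc h g f)
    (fun x Z => b_id2 (act ph (act pg (act pf Z)))).
Proof.
intros x Z; simpl. rewrite b_vid_l, !b_lw_vcomp, !b_vassoc, <- b_pentagon.
do 2 f_equal. rewrite <- !b_vassoc. f_equal. symmetry; apply b_assoc_nat1.
Qed.

Lemma Rel_assoc_inv {a b c d} {h : b_hom c d} {g : b_hom b c} {f : b_hom a b}
  (ph : pres c d h) (pg : pres b c g) (pf : pres a b f) :
  Rel (pcomp ph (pcomp pg pf)) (pcomp (pcomp ph pg) pf) (b_assoc_inv h g f)
    (fun x Z => b_id2 (act ph (act pg (act pf Z)))).
Proof.
intros x Z.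
apply (vcomp_cancel_r _ _ (b_rw (b_assoc h g f) Z) (b_rw (b_assoc_inv h g f) Z)).
- now rewrite <- b_rw_vcomp, b_assoc_inv_r, b_rw_id.
- rewrite b_vassoc, <- b_rw_vcomp, b_assoc_inv_l, b_rw_id, b_vid_r, b_vassoc.
  rewrite (Rel_assoc ph pg pf x Z). simpl. now rewrite !b_vid_l.
Qed.

Lemma Rel_lunit {a b} {f : b_hom a b} (p : pres a b f) :
  Rel (pcomp pone p) p (b_lunit f) (fun x Z => b_id2 (act p Z)).
Proof.
intros x Z; simpl. rewrite b_vid_l, rw_lunit, <- !b_vassoc, b_lunit_nat. reflexivity.
Qed.

Lemma Rel_runit {a b} {f : b_hom a b} (p : pres a b f) :
  Rel (pcomp p pone) p (b_runit f) (fun x Z => b_id2 (act p Z)).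
Proof. intros x Z; simpl. now rewrite b_vid_l, b_triangle. Qed.

Lemma str_nat {a b} {f g : b_hom a b} (p : pres a b f) (q : pres a b g) (theta : b_cell f g)
  {x} {Z Z' : b_hom x a} (z : b_cell Z Z') :
  str p q theta Z' ∘ actm p z = actm q z ∘ str p q theta Z.
Proof.
apply (vcomp_cancel_r _ _ (nf p _) (nfi p _) (nf_nfi _ _)).
rewrite !b_vassoc, <- nf_nat, <- (Rel_str p q theta x Z), <- !b_vassoc.
rewrite <- (Rel_str p q theta x Z'), <- nf_nat, !b_vassoc. f_equal. apply b_interchange.
Qed.

Lemma str_inv {a b} {f g : b_hom a b} (p : pres a b f) (q : pres a b g)
  (theta : b_cell f g) (theta' : b_cell g f) {x} (Z : b_hom x a) :
  theta' ∘ theta = b_id2 f -> str q p theta' Z ∘ str p q theta Z = b_id2 _.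
Proof.
exact (fun H => Rel_fun (Rel_vcomp (Rel_str q p theta') (Rel_str p q theta)) (Rel_id p) H x Z).
Qed.

End Strictification.

Arguments pgen {B a b} f.
Arguments pone {B a}.
Arguments pcomp {B a b c g f} _ _.

(** Hook for the generating 2-cells: it is redefined wherever new ones appear, while [rel] treats
    the structural operations. *)
Ltac rel_leaf := fail.

Ltac rel := repeat match goal with
  | |- Rel _ _ (b_hcomp _ _) _ => unfold b_hcomp
  | |- Rel _ _ (_ ∘ _) _ => refine (Rel_vcomp _ _)
  | |- Rel _ _ (b_lw _ _) _ => refine (Rel_lw _ _)
  | |- Rel _ _ (b_rw _ _) _ => refine (Rel_rw _ _)
  | |- Rel _ _ (b_assoc _ _ _) _ => refine (Rel_assoc _ _ _)
  | |- Rel _ _ (b_assoc_inv _ _ _) _ => refine (Rel_assoc_inv _ _ _)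
  | |- Rel _ _ (b_lunit _) _ => refine (Rel_lunit _)
  | |- Rel _ _ (b_runit _) _ => refine (Rel_runit _)
  | |- Rel _ _ (b_id2 _) _ => refine (Rel_id _)
  | |- Rel _ _ _ _ => rel_leaf
  end.

(** Carries an equation [H] of 2-cells over to strict families: both sides are strictified between
    the bracketings [p] and [q], and the coherence cells, now identities, are rewritten away. *)
Ltac transfer H p q x Z :=
  match type of H with ?t = ?t' =>
    let R := fresh in let R' := fresh in let E := fresh in
    eassert (R : Rel p q t _) by rel;
    eassert (R' : Rel p q t' _) by rel;
    pose proof (Rel_fun R R' H x Z) as E;
    cbn [act actm] in E; autorewrite with strict in E;
    autorewrite with strict; exact E
  end.

Create HintDb strict.
#[export] Hint Rewrite @b_lw_vcomp @b_vassoc @b_vid_l @b_vid_r @b_lw_id : strict.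

(* Rewrites with an equation between composites of 2-cells, modulo associativity of vertical
   composition and functoriality of left whiskering. *)
Ltac chain E :=
  let H := fresh in
  pose proof E as H; autorewrite with strict in H; autorewrite with strict;
  first [ rewrite H
        | let H' := fresh in
          epose proof (postcomp H _) as H'; rewrite ?b_vassoc in H';
          erewrite H'; clear H' ];
  autorewrite with strict; clear H.

(** * Strict form of the coherence laws of a pseudofunctor on a category *)

Section StrictPseudofunctor.
Context {D : Category} {B : Bicategory} {F0 : ob D -> b_ob B} (P : PsFunCat D B F0).

Lemma cell_of_eq_irr {a b : b_ob B} {f : b_hom a b} (e : f = f) : cell_of_eq e = b_id2 f.
Proof. now rewrite (proof_irrelevance _ e eq_refl). Qed.

(* The factorization [cmp g f = h] is a parameter so that the coherence laws of these cells
   need no transport along equations between 1-morphisms. *)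
Definition comp_cell {a b c : D} {g : hom b c} {f : hom a b} {h : hom a c} (e : cmp g f = h) :
    b_cell (pf1 P h) (b_comp (pf1 P g) (pf1 P f)) :=
  match e in _ = h return b_cell (pf1 P h) _ with eq_refl => i2 (pf_comp P g f) end.

Definition pc {a b c : D} {g : hom b c} {f : hom a b} {h : hom a c} (e : cmp g f = h)
    {x} (Z : b_hom x (F0 a)) :
    b_cell (b_comp (pf1 P h) Z) (b_comp (pf1 P g) (b_comp (pf1 P f) Z)) :=
  str (pgen _) (pcomp (pgen _) (pgen _)) (comp_cell e) Z.

Definition pu (a : D) {x} (Z : b_hom x (F0 a)) : b_cell (b_comp (pf1 P (idm a)) Z) Z :=
  str (pgen _) pone (i2 (pf_id P a)) Z.

Lemma Rel_comp_cell {a b c : D} {g : hom b c} {f : hom a b} {h : hom a c} (e : cmp g f = h) :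
  Rel (pgen _) (pcomp (pgen _) (pgen _)) (comp_cell e) (@pc _ _ _ _ _ _ e).
Proof. apply Rel_str. Qed.

Lemma Rel_pf_comp {a b c : D} (g : hom b c) (f : hom a b) :
  Rel (pgen _) (pcomp (pgen _) (pgen _)) (i2 (pf_comp P g f)) (@pc _ _ _ g f _ eq_refl).
Proof. apply Rel_str. Qed.

Lemma Rel_pf_id (a : D) : Rel (pgen _) pone (i2 (pf_id P a)) (@pu a).
Proof. apply Rel_str. Qed.

Lemma pc_nat {a b c : D} {g : hom b c} {f : hom a b} {h : hom a c} (e : cmp g f = h)
  {x} {Z Z' : b_hom x (F0 a)} (z : b_cell Z Z') :
  pc e Z' ∘ b_lw _ z = b_lw _ (b_lw _ z) ∘ pc e Z.
Proof. exact (str_nat (pgen _) (pcomp (pgen _) (pgen _)) _ z). Qed.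

Lemma pu_nat {a : D} {x} {Z Z' : b_hom x (F0 a)} (z : b_cell Z Z') :
  pu a Z' ∘ b_lw _ z = z ∘ pu a Z.
Proof. exact (str_nat (pgen _) pone _ z). Qed.

Ltac rel_leaf ::= first [apply Rel_comp_cell | apply Rel_pf_comp | apply Rel_pf_id].

(** By proof irrelevance [e'] may be any equation of 1-cells, in particular the one that occurs in a
    pseudofunctor axiom. *)
Lemma comp_cell_cast {a b c : D} {g : hom b c} {f : hom a b} {h : hom a c} (e : cmp g f = h)
  (e' : pf1 P h = pf1 P (cmp g f)) : comp_cell e = i2 (pf_comp P g f) ∘ cell_of_eq e'.
Proof. destruct e; simpl. now rewrite cell_of_eq_irr, b_vid_r. Qed.

Lemma pc_assoc {a b c d : D} {h : hom c d} {g : hom b c} {f : hom a b}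
  {k : hom a c} {l : hom b d} {m : hom a d} (egf : cmp g f = k) (ehk : cmp h k = m)
  (ehg : cmp h g = l) (elf : cmp l f = m) {x} (Z : b_hom x (F0 a)) :
  b_lw (pf1 P h) (pc egf Z) ∘ pc ehk Z = pc ehg (b_comp (pf1 P f) Z) ∘ pc elf Z.
Proof.
destruct egf, ehg, elf.
assert (H := pf_assoc _ _ _ P _ _ _ _ h g f).
(* The transport along associativity in [C] is absorbed by [ehk], the one factorization that was not
   eliminated. *)
rewrite <- (comp_cell_cast ehk) in H.
symmetry.
transfer H (pgen (pf1 P (cmp (cmp h g) f)))
  (pcomp (pgen (pf1 P h)) (pcomp (pgen (pf1 P g)) (pgen (pf1 P f)))) x Z.
Qed.

Lemma pc_lunit {a b : D} {f : hom a b} (e : cmp (idm b) f = f) {x} (Z : b_hom x (F0 a)) :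
  pu b (b_comp (pf1 P f) Z) ∘ pc e Z = b_id2 _.
Proof.
assert (H := pf_lunit _ _ _ P _ _ f).
assert (H' : b_lunit _ ∘ (b_rw (i2 (pf_id P b)) _ ∘ comp_cell e) = b_id2 (pf1 P f)).
{ rewrite (comp_cell_cast e (f_equal (pf1 P) (eq_sym e))), <- !b_vassoc.
  rewrite <- !b_vassoc in H. rewrite H. clear H.
  (* With the composite replaced by a variable, one of the two equations can be eliminated; the
     other becomes a loop. *)
  generalize (cmp_idl f). clear. revert e. generalize (cmp (idm b) f). intros k <- e.
  now rewrite (proof_irrelevance _ e eq_refl), b_vid_l. }
transfer H' (pgen (pf1 P f)) (pgen (pf1 P f)) x Z.
Qed.

Lemma pc_runit {a b : D} {f : hom a b} (e : cmp f (idm a) = f) {x} (Z : b_hom x (F0 a)) :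
  b_lw (pf1 P f) (pu a Z) ∘ pc e Z = b_id2 _.
Proof.
assert (H := pf_runit _ _ _ P _ _ f).
assert (H' : b_runit _ ∘ (b_lw _ (i2 (pf_id P a)) ∘ comp_cell e) = b_id2 (pf1 P f)).
{ rewrite (comp_cell_cast e (f_equal (pf1 P) (eq_sym e))), <- !b_vassoc.
  rewrite <- !b_vassoc in H. rewrite H. clear H.
  generalize (cmp_idr f). clear. revert e. generalize (cmp f (idm a)). intros k <- e.
  now rewrite (proof_irrelevance _ e eq_refl), b_vid_l. }
transfer H' (pgen (pf1 P f)) (pgen (pf1 P f)) x Z.
Qed.
End StrictPseudofunctor.

(** * Pullback squares, their pasting, and isomorphisms *)

Section Pullbacks.
Context {C : Category}.

Definition is_iso {x y : C} (u : hom x y) : Prop :=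
  exists v : hom y x, cmp u v = idm y /\ cmp v u = idm x.

Lemma pullback_intro {c0 c1 c2 c3 : C} (t : hom c0 c1) (l : hom c0 c2) (r : hom c1 c3)
  (b : hom c2 c3) (comm : cmp r t = cmp b l)
  (lift : forall (x : C) (p : hom x c1) (q : hom x c2), cmp r p = cmp b q ->
     exists w : hom x c0, cmp t w = p /\ cmp l w = q)
  (mono : forall (x : C) (w w' : hom x c0), cmp t w = cmp t w' -> cmp l w = cmp l w' -> w = w') :
  is_pullback t l r b.
Proof.
split; auto. intros x p q H. destruct (lift x p q H) as [w [H1 H2]].
exists w; split; auto. intros w' [H1' H2']. apply mono; congruence.
Qed.

Lemma pullback_lift {c0 c1 c2 c3 : C} {t : hom c0 c1} {l : hom c0 c2} {r : hom c1 c3}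
  {b : hom c2 c3} (K : is_pullback t l r b) {x : C} (p : hom x c1) (q : hom x c2) :
  cmp r p = cmp b q -> exists w : hom x c0, cmp t w = p /\ cmp l w = q.
Proof. intros H. destruct (proj2 K x p q H) as [w [Hw _]]. now exists w. Qed.

Lemma pullback_mono {c0 c1 c2 c3 : C} {t : hom c0 c1} {l : hom c0 c2} {r : hom c1 c3}
  {b : hom c2 c3} (K : is_pullback t l r b) {x : C} (w w' : hom x c0) :
  cmp t w = cmp t w' -> cmp l w = cmp l w' -> w = w'.
Proof.
intros H1 H2. destruct (proj2 K x (cmp t w') (cmp l w')) as [w0 [_ Hw]].
{ rewrite <- !cmp_assoc. f_equal. apply (proj1 K). }
rewrite <- (Hw w), <- (Hw w'); auto.
Qed.

Lemma iso_mono {x y z : C} {u : hom x y} (Hu : is_iso u) (w w' : hom z x) :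
  cmp u w = cmp u w' -> w = w'.
Proof.
destruct Hu as [v [_ Hv]]. intros H. apply (f_equal (cmp v)) in H.
now rewrite <- !cmp_assoc, Hv, !cmp_idl in H.
Qed.

Lemma iso_factor {x y z : C} {u : hom x y} (Hu : is_iso u) (w : hom z y) :
  exists w', cmp u w' = w.
Proof.
destruct Hu as [v [Hv _]]. exists (cmp v w). now rewrite <- cmp_assoc, Hv, cmp_idl.
Qed.

Lemma pullback_top_unit {x y : C} (f : hom x y) : is_pullback f (idm x) (idm y) f.
Proof.
apply pullback_intro.
- now rewrite cmp_idl, cmp_idr.
- intros z p q H. exists q. rewrite !cmp_idl in *. auto.
- intros z w w' _ H. now rewrite !cmp_idl in H.
Qed.

Lemma pullback_left_unit {x y : C} (f : hom x y) : is_pullback (idm x) f f (idm y).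
Proof.
apply pullback_intro.
- now rewrite cmp_idl, cmp_idr.
- intros z p q H. exists p. rewrite !cmp_idl in *. auto.
- intros z w w' H _. now rewrite !cmp_idl in H.
Qed.

Lemma pullback_iso_apex {c0' c0 c1 c2 c3 : C} {t : hom c0 c1} {l : hom c0 c2} {r : hom c1 c3}
  {b : hom c2 c3} {u : hom c0' c0} {t' : hom c0' c1} {l' : hom c0' c2} :
  is_pullback t l r b -> is_iso u -> cmp t u = t' -> cmp l u = l' -> is_pullback t' l' r b.
Proof.
intros K Hu <- <-. apply pullback_intro.
- rewrite <- !cmp_assoc. f_equal. apply (proj1 K).
- intros x p q H. destruct (pullback_lift K p q H) as [w [<- <-]].
  destruct (iso_factor Hu w) as [w' <-]. exists w'. now rewrite !cmp_assoc.
- intros x w w' H1 H2. rewrite !cmp_assoc in *.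
  apply (iso_mono Hu), (pullback_mono K); auto.
Qed.

Lemma pullback_iso_left {x y z : C} {u : hom x y} (Hu : is_iso u) (t : hom y z) (t' : hom x z) :
  cmp t u = t' -> is_pullback t' u (idm z) t.
Proof.
intros e. apply (pullback_iso_apex (pullback_top_unit t) Hu e). apply cmp_idl.
Qed.

Lemma pullback_iso_top {x y z : C} {u : hom x y} (Hu : is_iso u) (l : hom y z) (l' : hom x z) :
  cmp l u = l' -> is_pullback u l' l (idm z).
Proof.
intros e. apply (pullback_iso_apex (pullback_left_unit l) Hu); auto. apply cmp_idl.
Qed.

Lemma pullback_iso {x y : C} {u : hom x y} (Hu : is_iso u) : is_pullback u u (idm y) (idm y).
Proof. apply pullback_iso_left; auto. apply cmp_idl. Qed.

(** Lifting the pair of identities gives a section of [u], and joint monicity makes it a two-sided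
    inverse. With [pullback_iso], the square required by [eta_S] exists precisely for
    isomorphisms. *)
Lemma iso_of_pullback {x y : C} {u : hom x y} :
  is_pullback u u (idm y) (idm y) -> is_iso u.
Proof.
intros H. destruct (pullback_lift H (idm y) (idm y) eq_refl) as [v [Hv _]].
exists v; split; auto.
assert (E : cmp u (cmp v u) = cmp u (idm x)) by now rewrite <- cmp_assoc, Hv, cmp_idl, cmp_idr.
now apply (pullback_mono H).
Qed.

Lemma pullback_vpaste {c0 c1 c2 c3 c4 c5 : C} {h0 : hom c0 c1} {l0 : hom c0 c2} {r0 : hom c1 c3}
  {h1 : hom c2 c3} {l1 : hom c2 c4} {r1 : hom c3 c5} {h2 : hom c4 c5} {l : hom c0 c4}
  {r : hom c1 c5} :
  is_pullback h0 l0 r0 h1 -> is_pullback h1 l1 r1 h2 -> cmp l1 l0 = l -> cmp r1 r0 = r ->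
  is_pullback h0 l r h2.
Proof.
intros T K <- <-. apply pullback_intro.
- now rewrite cmp_assoc, (proj1 T), <- cmp_assoc, (proj1 K), cmp_assoc.
- intros x p q H. rewrite cmp_assoc in H. destruct (pullback_lift K _ _ H) as [w [Hw <-]].
  symmetry in Hw. destruct (pullback_lift T _ _ Hw) as [w' [<- <-]].
  exists w'. now rewrite cmp_assoc.
- intros x w w' H1 H2. rewrite !cmp_assoc in H2. apply (pullback_mono T); auto.
  apply (pullback_mono K); auto. rewrite <- !cmp_assoc, <- (proj1 T), !cmp_assoc. congruence.
Qed.

(** The cancellation half of the pasting lemma; it supplies the common square in the associativity
    axiom. *)
Lemma pullback_hcancel {c0 c1 c2 c3 c4 c5 : C} {t0 : hom c0 c1} {v0 : hom c0 c2} {v1 : hom c1 c3}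
  {b0 : hom c2 c3} {t1 : hom c1 c4} {v2 : hom c4 c5} {b1 : hom c3 c5} {t : hom c0 c4}
  {b : hom c2 c5} :
  is_pullback t v0 v2 b -> is_pullback t1 v1 v2 b1 -> cmp t1 t0 = t -> cmp b1 b0 = b ->
  cmp v1 t0 = cmp b0 v0 -> is_pullback t0 v0 v1 b0.
Proof.
intros K R <- <- comm. apply pullback_intro; auto.
- intros x p q H.
  destruct (pullback_lift K (cmp t1 p) q) as [w [H1 H2]].
  { now rewrite <- cmp_assoc, (proj1 R), !cmp_assoc, H. }
  exists w; split; auto. apply (pullback_mono R).
  + now rewrite <- cmp_assoc.
  + now rewrite <- cmp_assoc, comm, cmp_assoc, H2.
- intros x w w' H1 H2. apply (pullback_mono K); auto. now rewrite !cmp_assoc, H1.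
Qed.

End Pullbacks.

(** * Strict form of the laws of a Beck-Chevalley system *)

Section StrictBeckChevalley.
Context {C : Category} {B : Bicategory} (S : PBC C B).
Local Notation F0 := (pbc_ob S).
Local Notation U := (Um S).
Local Notation V := (Vm S).

Definition uc {a b c : C} {g : hom b c} {f : hom a b} {h : hom a c} (e : cmp g f = h)
    {x} (Z : b_hom x (F0 a)) : b_cell (b_comp (U h) Z) (b_comp (U g) (b_comp (U f) Z)) :=
  pc (pbcU S) e Z.

Definition vc {a b c : C} {g : hom b c} {f : hom a b} {h : hom a c} (e : cmp g f = h)
    {x} (Z : b_hom x (F0 c)) : b_cell (b_comp (V h) Z) (b_comp (V f) (b_comp (V g) Z)) :=
  @pc (op C) B F0 (pbcV S) c b a f g h e x Z.

Definition ui (a : C) {x} (Z : b_hom x (F0 a)) : b_cell (b_comp (U (idm a)) Z) Z :=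
  pu (pbcU S) a Z.

Definition vi (a : C) {x} (Z : b_hom x (F0 a)) : b_cell (b_comp (V (idm a)) Z) Z :=
  @pu (op C) B F0 (pbcV S) a x Z.

Definition bc {c0 c1 c2 c3 : C} {t : hom c0 c1} {l : hom c0 c2} {r : hom c1 c3} {b : hom c2 c3}
    (K : is_pullback t l r b) {x} (Z : b_hom x (F0 c1)) :
    b_cell (b_comp (V b) (b_comp (U r) Z)) (b_comp (U l) (b_comp (V t) Z)) :=
  str (pcomp (pgen (V b)) (pgen (U r))) (pcomp (pgen (U l)) (pgen (V t))) (i2 (BC S K)) Z.

Definition bci {c0 c1 c2 c3 : C} {t : hom c0 c1} {l : hom c0 c2} {r : hom c1 c3} {b : hom c2 c3}
    (K : is_pullback t l r b) {x} (Z : b_hom x (F0 c1)) :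
    b_cell (b_comp (U l) (b_comp (V t) Z)) (b_comp (V b) (b_comp (U r) Z)) :=
  str (pcomp (pgen (U l)) (pgen (V t))) (pcomp (pgen (V b)) (pgen (U r))) (i2_inv (BC S K)) Z.

Lemma Rel_Ucomp {a b c : C} (g : hom b c) (f : hom a b) :
  Rel (pgen _) (pcomp (pgen _) (pgen _)) (i2 (Ucomp S g f)) (@uc _ _ _ g f _ eq_refl).
Proof. apply Rel_str. Qed.

Lemma Rel_Vcomp {a b c : C} (g : hom b c) (f : hom a b) :
  Rel (pgen _) (pcomp (pgen _) (pgen _)) (i2 (Vcomp S g f)) (@vc _ _ _ g f _ eq_refl).
Proof. apply Rel_str. Qed.

Lemma Rel_Uid (a : C) : Rel (pgen _) pone (i2 (Uid S a)) (@ui a).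
Proof. apply Rel_str. Qed.

Lemma Rel_Vid (a : C) : Rel (pgen _) pone (i2 (Vid S a)) (@vi a).
Proof. apply Rel_str. Qed.

Lemma Rel_BC {c0 c1 c2 c3 : C} {t : hom c0 c1} {l : hom c0 c2} {r : hom c1 c3} {b : hom c2 c3}
  (K : is_pullback t l r b) :
  Rel (pcomp (pgen _) (pgen _)) (pcomp (pgen _) (pgen _)) (i2 (BC S K)) (@bc _ _ _ _ _ _ _ _ K).
Proof. apply Rel_str. Qed.

Lemma Rel_BC_inv {c0 c1 c2 c3 : C} {t : hom c0 c1} {l : hom c0 c2} {r : hom c1 c3}
  {b : hom c2 c3} (K : is_pullback t l r b) :
  Rel (pcomp (pgen _) (pgen _)) (pcomp (pgen _) (pgen _)) (i2_inv (BC S K))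
    (@bci _ _ _ _ _ _ _ _ K).
Proof. apply Rel_str. Qed.

Ltac rel_leaf ::= first [apply Rel_Ucomp | apply Rel_Vcomp | apply Rel_Uid | apply Rel_Vid
  | apply Rel_BC | apply Rel_BC_inv].

Lemma uc_nat {a b c : C} {g : hom b c} {f : hom a b} {h : hom a c} (e : cmp g f = h)
  {x} {Z Z' : b_hom x (F0 a)} (z : b_cell Z Z') :
  uc e Z' ∘ b_lw (U h) z = b_lw (U g) (b_lw (U f) z) ∘ uc e Z.
Proof. apply pc_nat. Qed.

Lemma ui_nat {a : C} {x} {Z Z' : b_hom x (F0 a)} (z : b_cell Z Z') :
  ui a Z' ∘ b_lw (U (idm a)) z = z ∘ ui a Z.
Proof. apply pu_nat. Qed.

Lemma vi_nat {a : C} {x} {Z Z' : b_hom x (F0 a)} (z : b_cell Z Z') :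
  vi a Z' ∘ b_lw (V (idm a)) z = z ∘ vi a Z.
Proof. exact (@pu_nat (op C) B F0 (pbcV S) a x Z Z' z). Qed.

Section Square.
Context {c0 c1 c2 c3 : C} {t : hom c0 c1} {l : hom c0 c2} {r : hom c1 c3} {b : hom c2 c3}
  (K : is_pullback t l r b) {x : b_ob B}.

Lemma bc_nat {Z Z' : b_hom x (F0 c1)} (z : b_cell Z Z') :
  bc K Z' ∘ b_lw (V b) (b_lw (U r) z) = b_lw (U l) (b_lw (V t) z) ∘ bc K Z.
Proof. exact (str_nat (pcomp (pgen _) (pgen _)) (pcomp (pgen _) (pgen _)) _ z). Qed.

Lemma bci_nat {Z Z' : b_hom x (F0 c1)} (z : b_cell Z Z') :
  bci K Z' ∘ b_lw (U l) (b_lw (V t) z) = b_lw (V b) (b_lw (U r) z) ∘ bci K Z.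
Proof. exact (str_nat (pcomp (pgen _) (pgen _)) (pcomp (pgen _) (pgen _)) _ z). Qed.

Lemma bc_bci (Z : b_hom x (F0 c1)) : bc K Z ∘ bci K Z = b_id2 _.
Proof.
exact (str_inv (pcomp (pgen _) (pgen _)) (pcomp (pgen _) (pgen _)) _ _ Z
  (i2_r _ _ _ _ _ (BC S K))).
Qed.

Lemma bci_bc (Z : b_hom x (F0 c1)) : bci K Z ∘ bc K Z = b_id2 _.
Proof.
exact (str_inv (pcomp (pgen _) (pgen _)) (pcomp (pgen _) (pgen _)) _ _ Z
  (i2_l _ _ _ _ _ (BC S K))).
Qed.

Lemma bc_epi {Z : b_hom x (F0 c1)} {h} (y z : b_cell _ h) : y ∘ bc K Z = z ∘ bc K Z -> y = z.
Proof. apply (vcomp_cancel_r _ _ _ _ (bc_bci Z)). Qed.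

Lemma bc_mono {Z : b_hom x (F0 c1)} {h} (y z : b_cell h _) : bc K Z ∘ y = bc K Z ∘ z -> y = z.
Proof. apply (vcomp_cancel_l _ _ _ _ (bci_bc Z)). Qed.
End Square.

Lemma uc_assoc {a b c d : C} {h : hom c d} {g : hom b c} {f : hom a b}
  {k : hom a c} {l : hom b d} {m : hom a d} (egf : cmp g f = k) (ehk : cmp h k = m)
  (ehg : cmp h g = l) (elf : cmp l f = m) {x} (Z : b_hom x (F0 a)) :
  b_lw (U h) (uc egf Z) ∘ uc ehk Z = uc ehg (b_comp (U f) Z) ∘ uc elf Z.
Proof. apply pc_assoc. Qed.

Lemma vc_assoc {a b c d : C} {h : hom c d} {g : hom b c} {f : hom a b}
  {k : hom a c} {l : hom b d} {m : hom a d} (egf : cmp g f = k) (ehk : cmp h k = m)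
  (ehg : cmp h g = l) (elf : cmp l f = m) {x} (Z : b_hom x (F0 d)) :
  vc egf (b_comp (V h) Z) ∘ vc ehk Z = b_lw (V f) (vc ehg Z) ∘ vc elf Z.
Proof.
symmetry. exact (@pc_assoc (op C) B F0 (pbcV S) d c b a f g h l k m ehg elf egf ehk x Z).
Qed.

Lemma uc_lunit {a b : C} {f : hom a b} (e : cmp (idm b) f = f) {x} (Z : b_hom x (F0 a)) :
  ui b (b_comp (U f) Z) ∘ uc e Z = b_id2 _.
Proof. apply pc_lunit. Qed.

Lemma uc_runit {a b : C} {f : hom a b} (e : cmp f (idm a) = f) {x} (Z : b_hom x (F0 a)) :
  b_lw (U f) (ui a Z) ∘ uc e Z = b_id2 _.
Proof. apply pc_runit. Qed.

(** Composition is reversed in [op C], so the left unit law in [C] comes from the right unit law of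
    the pseudofunctor, and conversely below. *)
Lemma vc_lunit {a b : C} {f : hom a b} (e : cmp (idm b) f = f) {x} (Z : b_hom x (F0 b)) :
  b_lw (V f) (vi b Z) ∘ vc e Z = b_id2 _.
Proof. exact (@pc_runit (op C) B F0 (pbcV S) b a f e x Z). Qed.

Lemma vc_runit {a b : C} {f : hom a b} (e : cmp f (idm a) = f) {x} (Z : b_hom x (F0 b)) :
  vi a (b_comp (V f) Z) ∘ vc e Z = b_id2 _.
Proof. exact (@pc_lunit (op C) B F0 (pbcV S) b a f e x Z). Qed.

(** Keeping [et] and [eb] as parameters allows any square with equal legs to serve as the pasted
    one, for instance one with an identity composed into a leg. *)
Lemma bc_hpaste {c0 c1 c2 c3 c4 c5 : C} {t0 : hom c0 c1} {v0 : hom c0 c2} {v1 : hom c1 c3}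
  {b0 : hom c2 c3} {t1 : hom c1 c4} {v2 : hom c4 c5} {b1 : hom c3 c5} {t : hom c0 c4}
  {b : hom c2 c5} (L : is_pullback t0 v0 v1 b0) (R : is_pullback t1 v1 v2 b1)
  (K : is_pullback t v0 v2 b) (et : cmp t1 t0 = t) (eb : cmp b1 b0 = b)
  {x} (Z : b_hom x (F0 c4)) :
  b_lw (U v0) (vc et Z) ∘ bc K Z
  = bc L (b_comp (V t1) Z) ∘ (b_lw (V b0) (bc R Z) ∘ vc eb (b_comp (U v2) Z)).
Proof.
destruct et, eb.
transfer (pbc_hpasting _ _ S _ _ _ _ _ _ t0 v0 v1 b0 t1 v2 b1 L R K)
  (pcomp (pgen (V (cmp b1 b0))) (pgen (U v2)))
  (pcomp (pgen (U v0)) (pcomp (pgen (V t0)) (pgen (V t1)))) x Z.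
Qed.

Lemma bc_vpaste {c0 c1 c2 c3 c4 c5 : C} {h0 : hom c0 c1} {l0 : hom c0 c2} {r0 : hom c1 c3}
  {h1 : hom c2 c3} {l1 : hom c2 c4} {r1 : hom c3 c5} {h2 : hom c4 c5} {l : hom c0 c4}
  {r : hom c1 c5} (T : is_pullback h0 l0 r0 h1) (K : is_pullback h1 l1 r1 h2)
  (TK : is_pullback h0 l r h2) (el : cmp l1 l0 = l) (er : cmp r1 r0 = r)
  {x} (Z : b_hom x (F0 c1)) :
  uc el (b_comp (V h0) Z) ∘ bc TK Z
  = b_lw (U l1) (bc T Z) ∘ (bc K (b_comp (U r0) Z) ∘ b_lw (V h2) (uc er Z)).
Proof.
destruct el, er.
transfer (pbc_vpasting _ _ S _ _ _ _ _ _ h0 l0 r0 h1 l1 r1 h2 T K TK)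
  (pcomp (pgen (V h2)) (pgen (U (cmp r1 r0))))
  (pcomp (pcomp (pgen (U l1)) (pgen (U l0))) (pgen (V h0))) x Z.
Qed.

Lemma bc_hunit {a b : C} {f : hom a b} (K : is_pullback (idm a) f f (idm b))
  {x} (Z : b_hom x (F0 a)) :
  b_lw (U f) (vi a Z) ∘ bc K Z = vi b (b_comp (U f) Z).
Proof.
transfer (pbc_hunit _ _ S _ _ f K) (pcomp (pgen (V (idm b))) (pgen (U f))) (pgen (U f)) x Z.
Qed.

Lemma bc_vunit {a b : C} {f : hom a b} (K : is_pullback f (idm a) (idm b) f)
  {x} (Z : b_hom x (F0 b)) :
  ui a (b_comp (V f) Z) ∘ bc K Z = b_lw (V f) (ui b Z).
Proof.
transfer (pbc_vunit _ _ S _ _ f K) (pcomp (pgen (V f)) (pgen (U (idm b)))) (pgen (V f)) x Z.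
Qed.
End StrictBeckChevalley.

Opaque uc vc ui vi bc bci.

(** * Isomorphisms acting on pullback squares, and the pseudofunctor axioms in strict form *)

Section SpanCalculus.
Context {C : Category} {B : Bicategory} (S : PBC C B).
Local Notation F0 := (pbc_ob S).
Local Notation U := (Um S).
Local Notation V := (Vm S).
Local Notation uc := (uc S).
Local Notation vc := (vc S).
Local Notation ui := (ui S).
Local Notation vi := (vi S).
Local Notation bc := (bc S).
Local Notation bci := (bci S).

(** Strict form of [eta_S], whose left unitor has become an identity. *)
Definition eta {a b : C} {u : hom a b} (H : is_pullback u u (idm b) (idm b))
    {x} (Z : b_hom x (F0 b)) : b_cell (b_comp (U u) (b_comp (V u) Z)) Z :=
  vi b Z ∘ (b_lw (V (idm b)) (ui b Z) ∘ bci H Z).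

Lemma eta_nat {a b : C} {u : hom a b} (H : is_pullback u u (idm b) (idm b))
  {x} {Z Z' : b_hom x (F0 b)} (z : b_cell Z Z') :
  eta H Z' ∘ b_lw (U u) (b_lw (V u) z) = z ∘ eta H Z.
Proof.
unfold eta. chain (bci_nat S H z). 
chain (f_equal (b_lw (V (idm b))) (ui_nat S z)). chain (vi_nat S z). reflexivity.
Qed.

(** [K] is the horizontal pasting of the square [H] with the vertical unit square on [t]. Hence the
    cell of [K] is inverse to [eta] up to unit and composition cells. *)
Lemma eta_bc_left {c0 c1 c2 : C} {u : hom c0 c1} (H : is_pullback u u (idm c1) (idm c1))
  {t : hom c1 c2} {t' : hom c0 c2} (K : is_pullback t' u (idm c2) t) (et : cmp t u = t')
  {x} (Z : b_hom x (F0 c2)) :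
  eta H (b_comp (V t) Z) ∘ (b_lw (U u) (vc et Z) ∘ bc K Z) = b_lw (V t) (ui c2 Z).
Proof.
unfold eta.
chain (bc_hpaste S H (pullback_top_unit t) K et (cmp_idr t) Z).
chain (bci_bc S H (b_comp (V t) Z)).
chain (f_equal (b_lw (V (idm c1))) (bc_vunit S (pullback_top_unit t) Z)).
chain (vi_nat S (b_lw (V t) (ui c2 Z))).
chain (vc_runit S (cmp_idr t) (b_comp (U (idm c2)) Z)). reflexivity.
Qed.

(** Here [K] is the vertical pasting of [H] with the horizontal unit square on [l]. *)
Lemma eta_bc_top {c0 c1 c2 : C} {u : hom c0 c1} (H : is_pullback u u (idm c1) (idm c1))
  {l : hom c1 c2} {l' : hom c0 c2} (K : is_pullback u l' l (idm c2)) (el : cmp l u = l')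
  {x} (Z : b_hom x (F0 c1)) :
  b_lw (U l) (eta H Z) ∘ (uc el (b_comp (V u) Z) ∘ bc K Z) = vi c2 (b_comp (U l) Z).
Proof.
unfold eta.
chain (bc_vpaste S H (pullback_left_unit l) K el (cmp_idr l) Z).
chain (f_equal (b_lw (U l)) (bci_bc S H Z)).
chain (f_equal (b_lw (U l)) (vi_nat S (ui c1 Z))).
chain (bc_hunit S (pullback_left_unit l) (b_comp (U (idm c1)) Z)).
chain (eq_sym (vi_nat S (b_lw (U l) (ui c1 Z)))).
chain (f_equal (b_lw (V (idm c2))) (uc_runit S (cmp_idr l) Z)). reflexivity.
Qed.

(** [K'] arises by pasting on top of [K] a square with left leg [u] and right leg an identity, whose
    cell is known from [eta_bc_left]. *)
Lemma bci_iso_apex {c0' c0 c1 c2 c3 : C} {u : hom c0' c0} (H : is_pullback u u (idm c0) (idm c0))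
  {t : hom c0 c1} {l : hom c0 c2} {r : hom c1 c3} {b : hom c2 c3} {t' : hom c0' c1}
  {l' : hom c0' c2} (K : is_pullback t l r b) (K' : is_pullback t' l' r b)
  (et : cmp t u = t') (el : cmp l u = l') {x} (Z : b_hom x (F0 c1)) :
  bci K Z ∘ (b_lw (U l) (eta H (b_comp (V t) Z)) ∘
    (uc el (b_comp (V u) (b_comp (V t) Z)) ∘ b_lw (U l') (vc et Z))) = bci K' Z.
Proof.
assert (T := pullback_iso_left (iso_of_pullback H) t t' et).
apply (bc_epi S K'), (bc_mono S K).
chain (bci_bc S K' Z). chain (bc_bci S K Z).
chain (uc_nat S el (vc et Z)).
chain (bc_vpaste S T K K' el (cmp_idr r) Z).
chain (f_equal (b_lw (U l)) (eta_bc_left H T et Z)).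
chain (eq_sym (bc_nat S K (ui c1 Z))).
chain (f_equal (b_lw (V b)) (uc_runit S (cmp_idr r) Z)). reflexivity.
Qed.

(** [K'] arises by pasting to the right of [K] a square with top [u] and bottom an identity, whose
    cell is known from [eta_bc_top]. *)
Lemma bci_iso_right {c0 c1 c1' c2 c3 : C} {u : hom c1 c1'}
  (H : is_pullback u u (idm c1') (idm c1'))
  {t : hom c0 c1} {l : hom c0 c2} {r : hom c1 c3} {b : hom c2 c3} {t' : hom c0 c1'}
  {r' : hom c1' c3} (K : is_pullback t l r b) (K' : is_pullback t' l r' b)
  (et : cmp u t = t') (er : cmp r' u = r) {x} (Z : b_hom x (F0 c1')) :
  b_lw (V b) (b_lw (U r') (eta H Z)) ∘ (b_lw (V b) (uc er (b_comp (V u) Z)) ∘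
    (bci K (b_comp (V u) Z) ∘ b_lw (U l) (vc et Z))) = bci K' Z.
Proof.
assert (G := pullback_iso_top (iso_of_pullback H) r' r er).
apply (bc_epi S K'). chain (bci_bc S K' Z).
chain (bc_hpaste S K G K' et (cmp_idl b) Z).
chain (bci_bc S K (b_comp (V u) Z)).
chain (f_equal (b_lw (V b)) (eta_bc_top H G er Z)).
chain (vc_lunit S (cmp_idl b) (b_comp (U r') Z)). reflexivity.
Qed.

(** [K'] arises by pasting below [K] a square with left leg [u] and right leg an identity, again
    covered by [eta_bc_left]. *)
Lemma bci_iso_bottom {c0 c1 c2 c2' c3 : C} {u : hom c2 c2'}
  (H : is_pullback u u (idm c2') (idm c2'))
  {t : hom c0 c1} {l : hom c0 c2} {r : hom c1 c3} {b : hom c2 c3} {l' : hom c0 c2'}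
  {b' : hom c2' c3} (K : is_pullback t l r b) (K' : is_pullback t l' r b')
  (el : cmp u l = l') (eb : cmp b' u = b) {x} (Z : b_hom x (F0 c1)) :
  eta H (b_comp (V b') (b_comp (U r) Z)) ∘ (b_lw (U u) (vc eb (b_comp (U r) Z)) ∘
    (b_lw (U u) (bci K Z) ∘ uc el (b_comp (V t) Z))) = bci K' Z.
Proof.
assert (G := pullback_iso_left (iso_of_pullback H) b' b eb).
apply (bc_epi S K'). chain (bci_bc S K' Z).
chain (bc_vpaste S K G K' el (cmp_idl r) Z).
chain (f_equal (b_lw (U u)) (bci_bc S K Z)).
chain (eta_bc_left H G eb (b_comp (U r) Z)).
chain (f_equal (b_lw (V b')) (uc_lunit S (cmp_idl r) Z)). reflexivity.
Qed.

(* Strict form of the action of the pseudofunctor on an isomorphism [u] of spans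
   from [(f, g)] to [(f', g')]. *)
Definition f3 {a c w w' : C} {f : hom w a} {g : hom w c} {f' : hom w' a} {g' : hom w' c}
    {u : hom w w'} (H : is_pullback u u (idm w') (idm w')) (ef : cmp f' u = f)
    (eg : cmp g' u = g) {x} (Z : b_hom x (F0 a)) :
    b_cell (b_comp (U g) (b_comp (V f) Z)) (b_comp (U g') (b_comp (V f') Z)) :=
  b_lw (U g') (eta H (b_comp (V f') Z)) ∘
    (uc eg (b_comp (V u) (b_comp (V f') Z)) ∘ b_lw (U g) (vc ef Z)).

(* Strict form of the composition constraint, for an arbitrary pullback square [K] over the
   cospan [(r, b)] and arbitrary factorizations of the outer legs. *)
Definition f4 {c0 c1 c2 c3 a d : C} {t : hom c0 c1} {l : hom c0 c2} {r : hom c1 c3}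
    {b : hom c2 c3} (K : is_pullback t l r b) {f : hom c1 a} {k : hom c2 d} {f2 : hom c0 a}
    {k2 : hom c0 d} (ef : cmp f t = f2) (ek : cmp k l = k2) {x} (Z : b_hom x (F0 a)) :
    b_cell (b_comp (U k2) (b_comp (V f2) Z))
      (b_comp (U k) (b_comp (V b) (b_comp (U r) (b_comp (V f) Z)))) :=
  b_lw (U k) (bci K (b_comp (V f) Z)) ∘
    (uc ek (b_comp (V t) (b_comp (V f) Z)) ∘ b_lw (U k2) (vc ef Z)).

Definition f5 (a : C) {x} (Z : b_hom x (F0 a)) :
    b_cell (b_comp (U (idm a)) (b_comp (V (idm a)) Z)) Z :=
  ui a Z ∘ b_lw (U (idm a)) (vi a Z).

(** The composition constraint is independent of the chosen pullback, up to the action of the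
    comparison isomorphism. Naturality and associativity of the composition cells regroup the
    factors until [bci_iso_apex] applies. *)
Lemma f4_iso_apex {c0' c0 c1 c2 c3 a d : C} {u : hom c0' c0}
  (H : is_pullback u u (idm c0) (idm c0)) {t : hom c0 c1} {l : hom c0 c2} {r : hom c1 c3}
  {b : hom c2 c3} {t' : hom c0' c1} {l' : hom c0' c2}
  (K : is_pullback t l r b) (K' : is_pullback t' l' r b)
  {f : hom c1 a} {k : hom c2 d} {f2 : hom c0 a} {k2 : hom c0 d} {f2' : hom c0' a}
  {k2' : hom c0' d} (ef : cmp f t = f2) (ek : cmp k l = k2) (ef' : cmp f t' = f2')
  (ek' : cmp k l' = k2') (eu : cmp f2 u = f2') (eu' : cmp k2 u = k2')
  (et : cmp t u = t') (el : cmp l u = l') {x} (Z : b_hom x (F0 a)) :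
  f4 K ef ek Z ∘ f3 H eu eu' Z = f4 K' ef' ek' Z.
Proof.
unfold f4, f3.
chain (eq_sym (f_equal (b_lw (U k2)) (eta_nat H (vc ef Z)))).
chain (uc_nat S ek (eta H (b_comp (V t) (b_comp (V f) Z)))).
chain (eq_sym (uc_nat S eu' (b_lw (V u) (vc ef Z)))).
chain (eq_sym (f_equal (b_lw (U k2')) (vc_assoc S et ef' ef eu Z))).
chain (eq_sym (uc_assoc S el ek' ek eu' (b_comp (V u) (b_comp (V t) (b_comp (V f) Z))))).
chain (uc_nat S ek' (vc et (b_comp (V f) Z))).
chain (eq_sym (f_equal (b_lw (U k)) (bci_iso_apex H K K' et el (b_comp (V f) Z)))).
reflexivity.
Qed.

(** For an identity the square of [eta] is a horizontal unit square, so its cell cancels and only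
    unit laws of [U] and [V] remain. *)
Lemma f3_id {a c w : C} {f : hom w a} {g : hom w c}
  (H : is_pullback (idm w) (idm w) (idm w) (idm w)) (ef : cmp f (idm w) = f)
  (eg : cmp g (idm w) = g) {x} (Z : b_hom x (F0 a)) : f3 H ef eg Z = b_id2 _.
Proof.
unfold f3, eta.
chain (f_equal (b_lw (U g)) (vi_nat S (ui w (b_comp (V f) Z)))).
chain (eq_sym (f_equal (b_lw (U g)) (bc_hunit S H (b_comp (V f) Z)))).
chain (f_equal (b_lw (U g)) (bc_bci S H (b_comp (V f) Z))).
chain (eq_sym (uc_nat S eg (vi w (b_comp (V f) Z)))).
chain (f_equal (b_lw (U g)) (vc_runit S ef Z)).
chain (uc_runit S eg (b_comp (V f) Z)). reflexivity.
Qed.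

(** The square [H'] defining [eta] for [v] is itself a pullback, so [f3] for [v] is the [f4] of that
    square followed by unit cells. Functoriality thus becomes a change of apex along [u]. *)
Lemma f3_comp {a c w w' w'' : C} {f : hom w a} {g : hom w c} {f' : hom w' a} {g' : hom w' c}
  {f'' : hom w'' a} {g'' : hom w'' c} {u : hom w w'} {v : hom w' w''} {vu : hom w w''}
  (H : is_pullback u u (idm w') (idm w')) (H' : is_pullback v v (idm w'') (idm w''))
  (H'' : is_pullback vu vu (idm w'') (idm w'')) (ef : cmp f' u = f) (eg : cmp g' u = g)
  (ef' : cmp f'' v = f') (eg' : cmp g'' v = g') (ef'' : cmp f'' vu = f)
  (eg'' : cmp g'' vu = g) (e : cmp v u = vu) {x} (Z : b_hom x (F0 a)) :
  f3 H' ef' eg' Z ∘ f3 H ef eg Z = f3 H'' ef'' eg'' Z.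
Proof.
assert (E := f4_iso_apex H H' H'' ef' eg' ef'' eg'' ef eg e e Z).
unfold f4 in E. unfold f3 in *. unfold eta at 1 3. 
chain E. reflexivity.
Qed.

Lemma f4_nat_l {c0 c0' c1 c1' c2 c3 a d : C} {u : hom c0 c0'} {v : hom c1 c1'}
  (Hu : is_pullback u u (idm c0') (idm c0')) (Hv : is_pullback v v (idm c1') (idm c1'))
  {t : hom c0 c1} {l : hom c0 c2} {r : hom c1 c3} {b : hom c2 c3}
  {t' : hom c0' c1'} {l' : hom c0' c2} {r' : hom c1' c3}
  (K : is_pullback t l r b) (K' : is_pullback t' l' r' b)
  {f : hom c1 a} {f' : hom c1' a} {k : hom c2 d} {f2 : hom c0 a} {k2 : hom c0 d}
  {f2' : hom c0' a} {k2' : hom c0' d}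
  (ef : cmp f t = f2) (ek : cmp k l = k2) (ef' : cmp f' t' = f2') (ek' : cmp k l' = k2')
  (euf : cmp f2' u = f2) (euk : cmp k2' u = k2) (evf : cmp f' v = f) (evr : cmp r' v = r)
  (et : cmp t' u = cmp v t) (el : cmp l' u = l) {x} (Z : b_hom x (F0 a)) :
  f4 K' ef' ek' Z ∘ f3 Hu euf euk Z
  = b_lw (U k) (b_lw (V b) (f3 Hv evf evr Z)) ∘ f4 K ef ek Z.
Proof.
(* [K''] has the apex of [K] and the cospan of [K']. The left side reaches it by a change of apex,
   the right side by a change of the right foot. *)
assert (K'' := pullback_iso_apex K' (iso_of_pullback Hu) et el).
assert (e : cmp f' (cmp v t) = f2) by (now rewrite <- cmp_assoc, evf).
rewrite (f4_iso_apex Hu K' K'' ef' ek' e ek euf euk et el Z).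
unfold f4, f3.
chain (eq_sym (f_equal (b_lw (U k)) (bci_nat S K (vc evf Z)))).
chain (eq_sym (uc_nat S ek (b_lw (V t) (vc evf Z)))).
chain (eq_sym (f_equal (b_lw (U k2)) (vc_assoc S eq_refl e evf ef Z))).
chain (uc_nat S ek (vc (eq_refl (cmp v t)) (b_comp (V f') Z))).
chain (f_equal (b_lw (U k)) (bci_iso_right Hv K K'' eq_refl evr (b_comp (V f') Z))).
reflexivity.
Qed.

Lemma f4_nat_r {c0 c0' c1 c2 c2' c3 a d : C} {u : hom c0 c0'} {v : hom c2 c2'}
  (Hu : is_pullback u u (idm c0') (idm c0')) (Hv : is_pullback v v (idm c2') (idm c2'))
  {t : hom c0 c1} {l : hom c0 c2} {r : hom c1 c3} {b : hom c2 c3}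
  {t' : hom c0' c1} {l' : hom c0' c2'} {b' : hom c2' c3}
  (K : is_pullback t l r b) (K' : is_pullback t' l' r b')
  {f : hom c1 a} {k : hom c2 d} {k' : hom c2' d} {f2 : hom c0 a} {k2 : hom c0 d}
  {f2' : hom c0' a} {k2' : hom c0' d}
  (ef : cmp f t = f2) (ek : cmp k l = k2) (ef' : cmp f t' = f2') (ek' : cmp k' l' = k2')
  (euf : cmp f2' u = f2) (euk : cmp k2' u = k2) (evb : cmp b' v = b) (evk : cmp k' v = k)
  (et : cmp t' u = t) (el : cmp l' u = cmp v l) {x} (Z : b_hom x (F0 a)) :
  f4 K' ef' ek' Z ∘ f3 Hu euf euk Z
  = f3 Hv evb evk (b_comp (U r) (b_comp (V f) Z)) ∘ f4 K ef ek Z.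
Proof.
(* The same intermediate square, now reached from [K] by changing the bottom foot of the cospan. *)
assert (K'' := pullback_iso_apex K' (iso_of_pullback Hu) et el).
assert (e : cmp k' (cmp v l) = k2) by (now rewrite <- cmp_assoc, evk).
rewrite (f4_iso_apex Hu K' K'' ef' ek' ef e euf euk et el Z).
unfold f4, f3.
chain (uc_nat S evk (vc evb (b_comp (U r) (b_comp (V f) Z)))).
chain (uc_nat S evk (bci K (b_comp (V f) Z))).
chain (eq_sym (uc_assoc S eq_refl e evk ek (b_comp (V t) (b_comp (V f) Z)))).
chain (f_equal (b_lw (U k')) (bci_iso_bottom Hv K K'' eq_refl evb (b_comp (V f) Z))).
reflexivity.
Qed.

(** The projection [t] identifies the apex with that of the horizontal unit square on [r]. After
    this change of apex the factor [f3] splits off, and on the unit square all cells cancel. *)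
Lemma f4_lunit {c0 c1 c2 a : C} {t : hom c0 c1} {l : hom c0 c2} {r : hom c1 c2}
  (K : is_pullback t l r (idm c2)) {f : hom c1 a} {f2 : hom c0 a} {k2 : hom c0 c2}
  (H : is_pullback t t (idm c1) (idm c1)) (ef ef' : cmp f t = f2) (ek : cmp (idm c2) l = k2)
  (er : cmp r t = k2) {x} (Z : b_hom x (F0 a)) :
  f5 c2 (b_comp (U r) (b_comp (V f) Z)) ∘ f4 K ef ek Z = f3 H ef' er Z.
Proof.
assert (el : cmp r t = l) by (rewrite (proj1 K); apply cmp_idl).
rewrite <- (f4_iso_apex H (pullback_left_unit r) K (cmp_idr f) (cmp_idl r) ef ek ef' er
  (cmp_idl t) el Z).
unfold f5, f4.
chain (ui_nat S (vi c2 (b_comp (U r) (b_comp (V f) Z)))).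
chain (ui_nat S (bci (pullback_left_unit r) (b_comp (V f) Z))).
chain (uc_lunit S (cmp_idl r) (b_comp (V (idm c1)) (b_comp (V f) Z))).
chain (eq_sym (bc_hunit S (pullback_left_unit r) (b_comp (V f) Z))).
chain (bc_bci S (pullback_left_unit r) (b_comp (V f) Z)).
chain (f_equal (b_lw (U r)) (vc_runit S (cmp_idr f) Z)). reflexivity.
Qed.

(** Dually, [l] identifies the apex with that of the vertical unit square on [b]. *)
Lemma f4_runit {c0 c1 c2 d : C} {t : hom c0 c1} {l : hom c0 c2} {b : hom c2 c1}
  (K : is_pullback t l (idm c1) b) {k : hom c2 d} {f2 : hom c0 c1} {k2 : hom c0 d}
  (H : is_pullback l l (idm c2) (idm c2)) (ef : cmp (idm c1) t = f2) (ek ek' : cmp k l = k2)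
  (eb : cmp b l = f2) {x} (Z : b_hom x (F0 c1)) :
  b_lw (U k) (b_lw (V b) (f5 c1 Z)) ∘ f4 K ef ek Z = f3 H eb ek' Z.
Proof.
assert (et : cmp b l = t) by (rewrite <- (proj1 K); apply cmp_idl).
rewrite <- (f4_iso_apex H (pullback_top_unit b) K (cmp_idl b) (cmp_idr k) ef ek eb ek'
  et (cmp_idl l) Z).
unfold f5, f4.
chain (eq_sym (f_equal (b_lw (U k)) (bci_nat S (pullback_top_unit b) (vi c1 Z)))).
chain (eq_sym (f_equal (b_lw (U k)) (bc_vunit S (pullback_top_unit b) Z))).
chain (f_equal (b_lw (U k)) (bc_bci S (pullback_top_unit b) Z)).
chain (eq_sym (uc_nat S (cmp_idr k) (b_lw (V b) (vi c1 Z)))).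
chain (f_equal (b_lw (U k)) (vc_lunit S (cmp_idl b) Z)).
chain (uc_runit S (cmp_idr k) (b_comp (V b) Z)). reflexivity.
Qed.

(** Both iterated pullbacks are pastings with one common square [T] over [(p2, q1)]: [KL] is [T] to
    the left of [KR], and [KP], after a change of apex along [u], is [T] above [KQ]. The two pasting
    laws then express both sides through the cells of [T], [KR] and [KQ]. *)
Lemma f4_assoc {a r q pl pr x y w b c d : C} {f : hom x a} {g : hom x b} {h : hom y b}
  {k : hom y c} {m : hom w c} {n : hom w d}
  {p1 : hom r x} {p2 : hom r y} (KR : is_pullback p1 p2 g h)
  {q1 : hom q y} {q2 : hom q w} (KQ : is_pullback q1 q2 k m)
  {hq : hom q b} (ehq : cmp h q1 = hq) {nq : hom q d} (enq : cmp n q2 = nq)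
  {kp : hom r c} (ekp : cmp k p2 = kp) {fp : hom r a} (efp : cmp f p1 = fp)
  {a1 : hom pl x} {a2 : hom pl q} (KL : is_pullback a1 a2 g hq)
  {c1 : hom pr r} {c2 : hom pr w} (KP : is_pullback c1 c2 kp m)
  {fa : hom pl a} (efa : cmp f a1 = fa) {na : hom pl d} (ena : cmp nq a2 = na)
  {fc : hom pr a} (efc : cmp fp c1 = fc) {nc : hom pr d} (enc : cmp n c2 = nc)
  {u : hom pl pr} (Hu : is_pullback u u (idm pr) (idm pr)) (euf : cmp fc u = fa)
  (eun : cmp nc u = na) (e1 : cmp p1 (cmp c1 u) = a1) (e2 : cmp p2 (cmp c1 u) = cmp q1 a2)
  (e3 : cmp c2 u = cmp q2 a2) {z} (Z : b_hom z (F0 a)) :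
  f4 KQ ehq enq (b_comp (U g) (b_comp (V f) Z)) ∘ f4 KL efa ena Z
  = b_lw (U n) (b_lw (V m) (f4 KR efp ekp Z)) ∘ (f4 KP efc enc Z ∘ f3 Hu euf eun Z).
Proof.
assert (T : is_pullback (cmp c1 u) a2 p2 q1) by exact (pullback_hcancel KL KR e1 ehq e2).
assert (K'' := pullback_vpaste T KQ eq_refl ekp).
assert (ef : cmp fp (cmp c1 u) = fa) by (now rewrite <- cmp_assoc, efc).
assert (en : cmp n (cmp q2 a2) = na) by (now rewrite <- cmp_assoc, enq).
rewrite (f4_iso_apex Hu KP K'' efc enc ef en euf eun eq_refl e3 Z).
(* [HP] and [VP] are the horizontal and vertical pasting laws, solved for the inverse Beck-Chevalley
   cells. *)
assert (HP : forall Y : b_hom z (F0 x), vc ehq (b_comp (U g) Y) ∘ bci KL Y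
  = b_lw (V q1) (bci KR Y) ∘ (bci T (b_comp (V p1) Y) ∘ b_lw (U a2) (vc e1 Y))).
{ intros Y. apply (bc_epi S KL). chain (bci_bc S KL Y). chain (bc_hpaste S T KR KL e1 ehq Y).
  chain (bci_bc S T (b_comp (V p1) Y)). chain (f_equal (b_lw (V q1)) (bci_bc S KR Y)).
  reflexivity. }
assert (VP : forall Y : b_hom z (F0 r), b_lw (V m) (uc ekp Y) ∘ bci K'' Y
  = bci KQ (b_comp (U p2) Y) ∘
    (b_lw (U q2) (bci T Y) ∘ uc (eq_refl (cmp q2 a2)) (b_comp (V (cmp c1 u)) Y))).
{ intros Y. apply (bc_epi S K''). chain (bci_bc S K'' Y).
  chain (bc_vpaste S T KQ K'' eq_refl ekp Y).
  chain (f_equal (b_lw (U q2)) (bci_bc S T Y)). chain (bci_bc S KQ (b_comp (U p2) Y)).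
  reflexivity. }
unfold f4.
chain (f_equal (b_lw (U nq)) (HP (b_comp (V f) Z))).
chain (uc_nat S enq (b_lw (V q1) (bci KR (b_comp (V f) Z)))).
chain (uc_nat S enq (bci T (b_comp (V p1) (b_comp (V f) Z)))).
chain (eq_sym (uc_nat S ena (vc e1 (b_comp (V f) Z)))).
chain (eq_sym (uc_assoc S eq_refl en enq ena
  (b_comp (V (cmp c1 u)) (b_comp (V p1) (b_comp (V f) Z))))).
chain (f_equal (b_lw (U n)) (bci_nat S KQ (bci KR (b_comp (V f) Z)))).
chain (f_equal (b_lw (U na)) (vc_assoc S e1 efa efp ef Z)).
chain (eq_sym (f_equal (b_lw (U n)) (bci_nat S K'' (vc efp Z)))).
chain (eq_sym (uc_nat S en (b_lw (V (cmp c1 u)) (vc efp Z)))).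
chain (f_equal (b_lw (U n)) (VP (b_comp (V p1) (b_comp (V f) Z)))).
reflexivity.
Qed.
End SpanCalculus.

(** * Invertible 2-cells *)

Section Invertible.
Context {B : Bicategory}.

(** Only the inverse is chosen; the forward cell remains the given [x], as the prescribed formulas
    for the constraints demand. *)
Definition iso2_of_inv {a b : b_ob B} {f g : b_hom a b} (x : b_cell f g) (H : is_inv2 x) :
    iso2 f g :=
  let (y, Hy) := constructive_indefinite_description _ H in
  {| i2 := x; i2_inv := y; i2_l := proj1 Hy; i2_r := proj2 Hy |}.

Lemma i2_iso2_of_inv {a b : b_ob B} {f g : b_hom a b} (x : b_cell f g) (H : is_inv2 x) :
  i2 (iso2_of_inv x H) = x.
Proof. unfold iso2_of_inv. now destruct constructive_indefinite_description. Qed.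

Lemma inv2_vcomp {a b : b_ob B} {f g h : b_hom a b} (x : b_cell g h) (y : b_cell f g) :
  is_inv2 x -> is_inv2 y -> is_inv2 (x ∘ y).
Proof.
intros [x' [Hx Hx']] [y' [Hy Hy']]. exists (y' ∘ x'). split.
- now rewrite b_vassoc, <- (b_vassoc _ _ _ _ _ _ _ x' x), Hx, b_vid_l.
- now rewrite b_vassoc, <- (b_vassoc _ _ _ _ _ _ _ y y'), Hy', b_vid_l.
Qed.

Lemma inv2_lw {a b c : b_ob B} (g : b_hom b c) {f f' : b_hom a b} (x : b_cell f f') :
  is_inv2 x -> is_inv2 (b_lw g x).
Proof.
intros [y [H H']]. exists (b_lw g y). now rewrite <- !b_lw_vcomp, H, H', !b_lw_id.
Qed.

Lemma inv2_rw {a b c : b_ob B} {g g' : b_hom b c} (x : b_cell g g') (f : b_hom a b) :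
  is_inv2 x -> is_inv2 (b_rw x f).
Proof.
intros [y [H H']]. exists (b_rw y f). now rewrite <- !b_rw_vcomp, H, H', !b_rw_id.
Qed.

Lemma inv2_i2 {a b : b_ob B} {f g : b_hom a b} (x : iso2 f g) : is_inv2 (i2 x).
Proof. exists (i2_inv x). split; [apply i2_l | apply i2_r]. Qed.

Lemma inv2_i2_inv {a b : b_ob B} {f g : b_hom a b} (x : iso2 f g) : is_inv2 (i2_inv x).
Proof. exists (i2 x). split; [apply i2_r | apply i2_l]. Qed.

Lemma inv2_assoc {a b c d : b_ob B} (h : b_hom c d) (g : b_hom b c) (f : b_hom a b) :
  is_inv2 (b_assoc h g f).
Proof. exists (b_assoc_inv h g f). split; [apply b_assoc_inv_l | apply b_assoc_inv_r]. Qed.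

Lemma inv2_assoc_inv {a b c d : b_ob B} (h : b_hom c d) (g : b_hom b c) (f : b_hom a b) :
  is_inv2 (b_assoc_inv h g f).
Proof. exists (b_assoc h g f). split; [apply b_assoc_inv_r | apply b_assoc_inv_l]. Qed.

Lemma inv2_lunit {a b : b_ob B} (f : b_hom a b) : is_inv2 (b_lunit f).
Proof. exists (b_lunit_inv f). split; [apply b_lunit_inv_l | apply b_lunit_inv_r]. Qed.

Lemma Rel_ext {a b : b_ob B} {f g : b_hom a b} {p : pres a b f} {q : pres a b g}
  {theta : b_cell f g} {tau tau'} :
  Rel p q theta tau -> (forall x Z, tau x Z = tau' x Z) -> Rel p q theta tau'.
Proof. intros H E x Z. now rewrite <- E. Qed.
End Invertible.

Ltac inv2 := repeat first [apply inv2_vcomp | apply inv2_lw | apply inv2_rw | apply inv2_i2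
  | apply inv2_i2_inv | apply inv2_assoc | apply inv2_assoc_inv | apply inv2_lunit].

(** * Apex maps underlying the 2-cells of spans *)

Section SpanMaps.
Context {C : PbCategory}.

Lemma svcomp_map {a b : C} {X Y Z : span a b} (y : smap Y Z) (x : smap X Y) :
  proj1_sig (svcomp C y x) = cmp (proj1_sig y) (proj1_sig x).
Proof. now destruct y as [n []], x as [m []]. Qed.

(** The lift inside [slw] is obtained by choice, so its two projections are all that later arguments
    use; likewise for [srw] and [sassoc]. *)
Lemma slw_map {a b c : C} (Y : span b c) {X X' : span a b} (x : smap X X') :
  cmp (pb_p1 (pullback (sr X') (sl Y))) (proj1_sig (slw C Y x))
  = cmp (proj1_sig x) (pb_p1 (pullback (sr X) (sl Y)))
  /\ cmp (pb_p2 (pullback (sr X') (sl Y))) (proj1_sig (slw C Y x))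
  = pb_p2 (pullback (sr X) (sl Y)).
Proof. destruct x as [m []]. unfold slw. destruct pb_lift as [u []]. auto. Qed.

Lemma srw_map {a b c : C} {Y Y' : span b c} (y : smap Y Y') (X : span a b) :
  cmp (pb_p1 (pullback (sr X) (sl Y'))) (proj1_sig (srw C y X))
  = pb_p1 (pullback (sr X) (sl Y))
  /\ cmp (pb_p2 (pullback (sr X) (sl Y'))) (proj1_sig (srw C y X))
  = cmp (proj1_sig y) (pb_p2 (pullback (sr X) (sl Y))).
Proof. destruct y as [m []]. unfold srw. destruct pb_lift as [u []]. auto. Qed.

Lemma sassoc_map {a b c d : C} (Z : span c d) (Y : span b c) (X : span a b) :
  let u := proj1_sig (sassoc C Z Y X) in
  let c1 := pb_p1 (pullback (sr (scomp C Y X)) (sl Z)) in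
  let c2 := pb_p2 (pullback (sr (scomp C Y X)) (sl Z)) in
  let a1 := pb_p1 (pullback (sr X) (sl (scomp C Z Y))) in
  let a2 := pb_p2 (pullback (sr X) (sl (scomp C Z Y))) in
  cmp (pb_p1 (pullback (sr X) (sl Y))) (cmp c1 u) = a1 /\
  cmp (pb_p2 (pullback (sr X) (sl Y))) (cmp c1 u) = cmp (pb_p1 (pullback (sr Y) (sl Z))) a2 /\
  cmp c2 u = cmp (pb_p2 (pullback (sr Y) (sl Z))) a2.
Proof.
unfold sassoc. destruct pb_lift as [v [H1 H2]]. destruct pb_lift as [u [H3 H4]].
split; [exact (eq_trans (f_equal _ H3) H1)|].
split; [exact (eq_trans (f_equal _ H3) H2) | exact H4].
Qed.

Lemma smap_iso {a b : C} {X Y : span a b} (x : smap X Y) :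
  @is_inv2 (SpanData C) a b X Y x -> is_iso (proj1_sig x).
Proof.
intros [y [H H']]. exists (proj1_sig y).
split.
- exact (eq_trans (eq_sym (svcomp_map x y)) (f_equal (@proj1_sig _ _) H')).
- exact (eq_trans (eq_sym (svcomp_map y x)) (f_equal (@proj1_sig _ _) H)).
Qed.
End SpanMaps.

Ltac rel_leaf ::= first [apply Rel_Ucomp | apply Rel_Vcomp | apply Rel_Uid | apply Rel_Vid
  | apply Rel_BC | apply Rel_BC_inv].

(** * Strict forms of the prescribed formulas *)

Section Formulas.
Context {C : PbCategory} {B : Bicategory} (S : PBC C B).

Definition pspan {a b : C} (X : span a b) : pres _ _ (spanF1 S a b X) :=
  pcomp (pgen (Um S (sr X))) (pgen (Vm S (sl X))).

Lemma Rel_F3 {a b : C} {X Y : span a b} (x : smap X Y)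
  (H : is_pullback (proj1_sig x) (proj1_sig x) (idm (apex Y)) (idm (apex Y)))
  (ef : cmp (sl Y) (proj1_sig x) = sl X) (eg : cmp (sr Y) (proj1_sig x) = sr X) :
  Rel (pspan X) (pspan Y) (F3formula S x H) (@f3 _ _ S _ _ _ _ _ _ _ _ _ H ef eg).
Proof.
destruct X as [w f g], x as [u ex]; simpl in *. destruct ef, eg.
unfold F3formula, eta_S, pspan, spanF1; cbn [proj1_sig proj2_sig sl sr apex].
(* With the legs of [X] replaced by composites, the transport in [F3formula] runs along a loop and
   is an identity. *)
match goal with |- context [cell_of_eq ?e] =>
  rewrite (proof_irrelevance (_ = b_comp (Um S (cmp (sr Y) u)) (Vm S (cmp (sl Y) u))) e eq_refl)
end; cbn [cell_of_eq].
eapply Rel_ext; [rel|].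
intros x Z; cbn [act actm]. unfold f3, eta. autorewrite with strict.
reflexivity.
Qed.

Lemma Rel_F4 {a b c : C} (X : span a b) (Y : span b c) :
  Rel (pspan (scomp C Y X)) (pcomp (pspan Y) (pspan X)) (F4formula S X Y)
    (@f4 _ _ S _ _ _ _ _ _ _ _ _ _ (pb_is (pullback (sr X) (sl Y))) _ _ _ _
       (eq_refl (sl (scomp C Y X))) (eq_refl (sr (scomp C Y X)))).
Proof.
unfold F4formula, pspan, spanF1. eapply Rel_ext; [rel|].
intros x Z; cbn [act actm]. unfold f4. autorewrite with strict.
reflexivity.
Qed.

Lemma Rel_F5 (a : C) : Rel (pspan (sid C a)) pone (F5formula S a) (@f5 _ _ S a).
Proof.
unfold F5formula, pspan, spanF1. eapply Rel_ext; [rel|].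
intros x Z; cbn [act actm]. unfold f5. autorewrite with strict.
reflexivity.
Qed.
End Formulas.

(** * Assembly of the pseudofunctor *)

Section Pseudofunctor.
Context {C : PbCategory} {B : Bicategory} (S : PBC C B).

Lemma F4_inv {a b c : C} (X : span a b) (Y : span b c) : is_inv2 (F4formula S X Y).
Proof. unfold F4formula, b_hcomp. inv2. Qed.

Lemma F5_inv (a : C) : is_inv2 (F5formula S a).
Proof. unfold F5formula, b_hcomp. inv2. Qed.

Definition smap_pullback {a b : C} {X Y : span a b} (x : smap X Y)
    (H : @is_inv2 (SpanData C) a b X Y x) :
    is_pullback (proj1_sig x) (proj1_sig x) (idm (apex Y)) (idm (apex Y)) :=
  pullback_iso (smap_iso x H).

Definition F2 {a b : C} {X Y : span a b} (x : smap X Y)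
    (H : @is_inv2 (SpanData C) a b X Y x) : b_cell (spanF1 S a b X) (spanF1 S a b Y) :=
  F3formula S x (smap_pullback x H).

Definition Fcomp {a b c : C} (Y : span b c) (X : span a b) :
    iso2 (spanF1 S a c (scomp C Y X)) (b_comp (spanF1 S b c Y) (spanF1 S a b X)) :=
  iso2_of_inv (F4formula S X Y) (F4_inv X Y).

Definition Fid (a : C) : iso2 (spanF1 S a a (sid C a)) (b_id1 (pbc_ob S a)) :=
  iso2_of_inv (F5formula S a) (F5_inv a).

Lemma Rel_F2 {a b : C} {X Y : span a b} (x : smap X Y) (H : @is_inv2 (SpanData C) a b X Y x) :
  Rel (pspan S X) (pspan S Y) (F2 x H)
    (@f3 _ _ S _ _ _ _ _ _ _ _ _ (smap_pullback x H) (proj1 (proj2_sig x))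
       (proj2 (proj2_sig x))).
Proof. apply Rel_F3. Qed.

Lemma Rel_Fcomp {a b c : C} (X : span a b) (Y : span b c) :
  Rel (pspan S (scomp C Y X)) (pcomp (pspan S Y) (pspan S X)) (i2 (Fcomp Y X))
    (@f4 _ _ S _ _ _ _ _ _ _ _ _ _ (pb_is (pullback (sr X) (sl Y))) _ _ _ _
       (eq_refl (sl (scomp C Y X))) (eq_refl (sr (scomp C Y X)))).
Proof. unfold Fcomp. rewrite i2_iso2_of_inv. apply Rel_F4. Qed.

Lemma Rel_Fid (a : C) : Rel (pspan S (sid C a)) pone (i2 (Fid a)) (@f5 _ _ S a).
Proof. unfold Fid. rewrite i2_iso2_of_inv. apply Rel_F5. Qed.

Ltac rel_leaf ::= first [apply Rel_F2 | apply Rel_Fcomp | apply Rel_Fid].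

(** By [Rel_inj], an equation between 2-cells follows from the equation between their strict
    families, to which the span calculus applies. *)
Ltac strictify p q :=
  eapply (Rel_inj (p := p) (q := q)); [rel | rel |];
  intros ? ?; cbn [act actm pspan].

Lemma F2_id {a b : C} (X : span a b) (H : @is_inv2 (SpanData C) a b X X (sid2 C X)) :
  F2 (sid2 C X) H = b_id2 _.
Proof. strictify (pspan S X) (pspan S X). apply f3_id. Qed.

Lemma F2_comp {a b : C} {X Y Z : span a b} (x : smap X Y) (y : smap Y Z)
  (Hx : @is_inv2 (SpanData C) a b X Y x) (Hy : @is_inv2 (SpanData C) a b Y Z y)
  (H : @is_inv2 (SpanData C) a b X Z (svcomp C y x)) :
  F2 (svcomp C y x) H = F2 y Hy ∘ F2 x Hx.
Proof.
strictify (pspan S X) (pspan S Z). symmetry. apply f3_comp. symmetry. apply svcomp_map.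
Qed.

Lemma Fcomp_nat_l {a b c : C} (Y : span b c) {X X' : span a b} (x : smap X X')
  (Hx : @is_inv2 (SpanData C) a b X X' x)
  (H : @is_inv2 (SpanData C) a c _ _ (slw C Y x)) :
  i2 (Fcomp Y X') ∘ F2 (slw C Y x) H = b_lw (spanF1 S b c Y) (F2 x Hx) ∘ i2 (Fcomp Y X).
Proof.
strictify (pspan S (scomp C Y X)) (pcomp (pspan S Y) (pspan S X')).
destruct (slw_map Y x). now apply f4_nat_l.
Qed.

Lemma Fcomp_nat_r {a b c : C} {Y Y' : span b c} (X : span a b) (y : smap Y Y')
  (Hy : @is_inv2 (SpanData C) b c Y Y' y)
  (H : @is_inv2 (SpanData C) a c _ _ (srw C y X)) :
  i2 (Fcomp Y' X) ∘ F2 (srw C y X) H = b_rw (F2 y Hy) (spanF1 S a b X) ∘ i2 (Fcomp Y X).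
Proof.
strictify (pspan S (scomp C Y X)) (pcomp (pspan S Y') (pspan S X)).
destruct (srw_map y X). now apply f4_nat_r.
Qed.

Lemma Fcomp_assoc {a b c d : C} (Z : span c d) (Y : span b c) (X : span a b)
  (H : @is_inv2 (SpanData C) a d _ _ (sassoc C Z Y X)) :
  b_assoc (spanF1 S c d Z) (spanF1 S b c Y) (spanF1 S a b X) ∘
    (b_rw (i2 (Fcomp Z Y)) (spanF1 S a b X) ∘ i2 (Fcomp (scomp C Z Y) X))
  = b_lw (spanF1 S c d Z) (i2 (Fcomp Y X)) ∘
    (i2 (Fcomp Z (scomp C Y X)) ∘ F2 (sassoc C Z Y X) H).
Proof.
strictify (pspan S (scomp C (scomp C Z Y) X))
  (pcomp (pspan S Z) (pcomp (pspan S Y) (pspan S X))).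
rewrite b_vid_l. destruct (sassoc_map Z Y X) as [H1 [H2 H3]].
now apply f4_assoc.
Qed.

Lemma Fcomp_lunit {a b : C} (X : span a b)
  (H : @is_inv2 (SpanData C) a b _ _ (slunit C X)) :
  b_lunit (spanF1 S a b X) ∘
    (b_rw (i2 (Fid b)) (spanF1 S a b X) ∘ i2 (Fcomp (sid C b) X)) = F2 (slunit C X) H.
Proof.
strictify (pspan S (scomp C (sid C b) X)) (pspan S X).
rewrite b_vid_l. apply f4_lunit.
Qed.

Lemma Fcomp_runit {a b : C} (X : span a b)
  (H : @is_inv2 (SpanData C) a b _ _ (srunit C X)) :
  b_runit (spanF1 S a b X) ∘
    (b_lw (spanF1 S a b X) (i2 (Fid a)) ∘ i2 (Fcomp X (sid C a))) = F2 (srunit C X) H.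
Proof.
strictify (pspan S (scomp C X (sid C a))) (pspan S X).
rewrite b_vid_l. apply f4_runit.
Qed.

Definition pith_psfun : PithPsFun (SpanData C) B (pbc_ob S) (spanF1 S) :=
  Build_PithPsFun (SpanData C) B (pbc_ob S) (spanF1 S)
    (fun a b X Y x H => @F2 a b X Y x H) (fun a b c Y X => @Fcomp a b c Y X) Fid
    (fun a b X H => @F2_id a b X H)
    (fun a b X Y Z x y Hx Hy H => @F2_comp a b X Y Z x y Hx Hy H)
    (fun a b c Y X X' x Hx H => @Fcomp_nat_l a b c Y X X' x Hx H)
    (fun a b c Y Y' X y Hy H => @Fcomp_nat_r a b c Y Y' X y Hy H)
    (fun a b c d Z Y X H => @Fcomp_assoc a b c d Z Y X H)
    (fun a b X H => @Fcomp_lunit a b X H)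
    (fun a b X H => @Fcomp_runit a b X H).
End Pseudofunctor.

(** The values on objects and on spans are fixed by the parameters [pbc_ob S] and [spanF1 S] in the
    type of [F]. *)
Theorem mainTheorem7 (C : PbCategory) (B : Bicategory) (S : PBC C B) :
  exists F : PithPsFun (SpanData C) B (pbc_ob S) (spanF1 S),
    (* (3) action on isomorphisms of spans *)
    (forall (a b : C) (X Y : span a b) (x : smap X Y) (Hx : @is_inv2 (SpanData C) a b X Y x)
        (Hpb : is_pullback (proj1_sig x) (proj1_sig x) (idm (apex Y)) (idm (apex Y))),
        pp2 F (x : @b_cell (SpanData C) a b X Y) Hx = F3formula S x Hpb) /\
    (* (4) composition isomorphisms *)
    (forall (a b c : C) (X : span a b) (Y : span b c),
        i2 (pp_comp F (Y : @b_hom (SpanData C) b c) X) = F4formula S X Y) /\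
    (* (5) unit isomorphisms *)
    (forall a : C, i2 (pp_id F a) = F5formula S a).
Proof.
exists (pith_psfun S). split; [|split].
- intros a b X Y x Hx Hpb. cbn. unfold F2.
  (* The formula is claimed for every proof that the square is a pullback, whereas [F2] uses a
     particular one. *)
  now rewrite (proof_irrelevance _ Hpb (smap_pullback x Hx)).
- intros a b c X Y. apply i2_iso2_of_inv.
- intros a. apply i2_iso2_of_inv.
Qed.
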